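(* Let $P$ be a lattice polytope of dimension $d$. Let $h_P(z)$ be the numerator polynomial of the Ehrhart series of the open polytope $P^{\circ}$, i.e. the polynomial with $\sum_{n=1}^{\infty} \mathrm{L}_{P^{\circ}}(n) z^n = \frac{h_P(z)}{(1-z)^{d+1}}$. Then $h_P$ can be decomposed as $$h_P(z) = a_P(z) - b_P(z),$$ where $a_P(z)$ and $b_P(z)$ are polynomials with nonnegative coefficients satisfying $a_P(z) = z^{d+1} a_P\left(\frac{1}{z}\right)$ and $b_P(z) = z^{d} b_P\left(\frac{1}{z}\right)$.
   Context: A lattice polytope of dimension $d$ is a $d$-dimensional convex polytope $P \subset \mathbb{R}^d$ with all vertices in $\mathbb{Z}^d$. $P^{\circ}$ denotes the interior of $P$, and $\mathrm{L}_{P^{\circ}}(n)$ is the number of points of $\mathbb{Z}^d$ in the interior of $nP$, for integers $n \ge 1$. The Ehrhart series of the open polytope is $\mathrm{Ehr}_{P^{\circ}}(z) = \sum_{n=1}^{\infty} \mathrm{L}_{P^{\circ}}(n) z^n$; it is a rational function of the form $h_P(z)/(1-z)^{d+1}$ with $h_P$ a polynomial. *)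

(* Defs.v *)
From HB Require Import structures.
From mathcomp Require Import all_boot all_order all_algebra finmap.
From mathcomp Require Import all_classical all_reals all_analysis.

Set Implicit Arguments.
Unset Strict Implicit.
Unset Printing Implicit Defensive.

Import Order.TTheory GRing.Theory Num.Theory.
Import numFieldNormedType.Exports.

Local Open Scope classical_set_scope.
Local Open Scope ring_scope.

Section Polytopes.
Variables (R : realType) (d : nat).
Implicit Types (A P : set 'rV[R]_d) (x : 'rV[R]_d).

Definition conv_hull A : set 'rV[R]_d :=
  [set x | exists (k : nat) (p : 'I_k -> 'rV[R]_d) (c : 'I_k -> R),
    [/\ forall i, A (p i), forall i, 0 <= c i, \sum_(i < k) c i = 1
      & x = \sum_(i < k) c i *: p i]].

Definition aff_hull A : set 'rV[R]_d :=
  [set x | exists (k : nat) (p : 'I_k -> 'rV[R]_d) (c : 'I_k -> R),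
    [/\ forall i, A (p i), \sum_(i < k) c i = 1
      & x = \sum_(i < k) c i *: p i]].

Definition convex_polytope P :=
  exists2 A : set 'rV[R]_d, finite_set A & P = conv_hull A.

(* The dimension of a set is that of its affine hull, a translate of a linear
   subspace; the empty set has no dimension in this sense. *)
Definition has_dim A (k : nat) :=
  exists (x0 : 'rV[R]_d) (U : {vspace 'rV[R]_d}),
    aff_hull A = [set x0 + u | u in [set u | u \in U]] /\ \dim U = k.

(* Vertices are extreme points. *)
Definition is_vertex P x :=
  P x /\ forall (y z : 'rV[R]_d) (t : R), P y -> P z -> 0 < t < 1 ->
    x = t *: y + (1 - t) *: z -> y = x /\ z = x.

Definition integer_points : set 'rV[R]_d :=
  [set x : 'rV[R]_d | forall i, x ord0 i \is a Num.int].

Definition lattice_polytope P :=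
  [/\ convex_polytope P, has_dim P d
    & forall x, is_vertex P x -> integer_points x].

Definition dilate (n : nat) P : set 'rV[R]_d := [set n%:R *: x | x in P].

(* [fset_set] sends infinite sets to the empty one; the set below is finite
   whenever P is a polytope, since P is then bounded. *)
Definition open_count P (n : nat) : nat :=
  #|` fset_set ((dilate n P)° `&` integer_points)|%fset.

(* A formal power series is given by its sequence of coefficients. *)
Definition open_ehrhart_series P : nat -> R :=
  fun n => if n == 0%N then 0 else (open_count P n)%:R.

End Polytopes.

Definition fps_mul (R : realType) (f g : nat -> R) : nat -> R :=
  fun n => \sum_(i < n.+1) f i * g (n - i)%N.

(* Ehr_{P^o}(z) = h(z) / (1-z)^(d+1) in R[[z]]: since (1-z)^(d+1) has constant
   term 1, it is invertible in R[[z]], so that the quotient is the unique series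
   whose product with (1-z)^(d+1) is h. In particular h is unique. *)
Definition open_ehrhart_numerator (R : realType) (d : nat)
    (P : set 'rV[R]_d) (h : {poly R}) :=
  forall n : nat,
    fps_mul (fun i => ((1 - 'X) ^+ d.+1 : {poly R})`_i)
            (open_ehrhart_series P) n = h`_n.

(* Main.v *)
(* Write [P] as the convex hull of lattice points [v_1, ..., v_m]. A generic cost
   on the vectors [(v_i, 1)] picks, by linear programming, a triangulation of the
   cone they span: its simplices are the bases that are optimal for some right-hand
   side. Let [q] be a generic positive combination of the [(v_i, 1)]. Assigning each
   lattice point [y] to the simplex containing [y + t q] for all small [t > 0] cuts
   the closed cone into half-open simplicial cones, and using [y - t q] cuts the
   interior into the complementary half-open cones. Each of them contributes to the
   numerator the number of lattice points of its fundamental parallelepiped at each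
   height, and [x |-> (sum of the generators) - x] exchanges the two families: the
   numerators [h] of the interior and [hs] of the closed polytope have nonnegative
   coefficients and satisfy [hs(z) = z^(d+1) h(1/z)].
   Projecting along [q] identifies the boundary of the cone with all of [R^d]: the
   boundary point above a given point is the one of least height. The same linear
   programming argument, applied to the projected generators with a cost close to
   the height, cuts the boundary into half-open simplicial cones with [d] generators,
   so that its numerator [b] has nonnegative coefficients, and
   [(1 - z) b = hs - h]. Hence [a = h + b] and [b] are as required. *)

Require Import Defs.
From HB Require Import structures.
From mathcomp Require Import all_boot all_order all_algebra finmap.
From mathcomp Require Import all_classical all_reals all_analysis.
From mathcomp Require Import ring lra.

Import Order.TTheory GRing.Theory Num.Theory.
Import numFieldNormedType.Exports.

Local Open Scope classical_set_scope.
Local Open Scope ring_scope.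

Set Implicit Arguments.
Unset Strict Implicit.
Unset Printing Implicit Defensive.

(** * Formal power series with denominator a power of 1 - z *)

(** Multiplication by [1 - z] on coefficient sequences, the coefficient before index 0 being 0. *)
Definition bdiff (R : realType) (f : nat -> R) (n : nat) : R :=
  f n - (if n is n'.+1 then f n' else 0).

(** Coefficient [n] of a product only sees [f] up to [n], so the series may be truncated and the
    ring laws of polynomials apply. *)
Lemma fps_mulE (R : realType) (p : {poly R}) (f : nat -> R) (N n : nat) :
  (n < N)%N ->
  fps_mul (fun i => p`_i) f n = (p * \poly_(i < N) f i)`_n.
Proof.
move=> ltnN; rewrite /fps_mul coefM; apply: eq_bigr => i _.
by rewrite coef_poly (leq_ltn_trans (leq_subr _ _) ltnN).
Qed.

Lemma fps_mul_sub1X (R : realType) (p : {poly R}) (f : nat -> R) (n : nat) :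
  fps_mul (fun i => ((1 - 'X) * p)`_i) f n = fps_mul (fun i => p`_i) (bdiff f) n.
Proof.
rewrite (@fps_mulE _ ((1 - 'X) * p) f n.+1)// mulrAC mulrC coefM /fps_mul.
apply: eq_bigr => i _; congr (_ * _).
rewrite mulrBl mul1r coefB coefXM !coef_poly /bdiff.
have : (n - i < n.+1)%N by rewrite ltnS leq_subr.
by case: (n - i)%N => [|k] kn; rewrite ?kn // (ltnW kn).
Qed.

(** Numerators become iterated differences, the form in which they are computed below. *)
Lemma fps_mul_sub1XX (R : realType) (f : nat -> R) (k n : nat) :
  fps_mul (fun i => ((1 - 'X) ^+ k : {poly R})`_i) f n = iter k (@bdiff _) f n.
Proof.
elim: k f n => [|k IHk] f n.
  rewrite (@fps_mulE _ _ _ n.+1)// expr0 mul1r coef_poly ltnSn//.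
by rewrite exprS fps_mul_sub1X IHk iterSr.
Qed.

Lemma iter_bdiff_sum (R : realType) (I : finType) (A : pred I)
    (f : I -> nat -> R) (k n : nat) :
  iter k (@bdiff _) (fun j => \sum_(i | A i) f i j) n =
  \sum_(i | A i) iter k (@bdiff _) (f i) n.
Proof.
elim: k n => [//|k IHk] n /=; rewrite {1}/bdiff IHk sumrB; congr (_ - _).
by case: n => [|n]; rewrite ?IHk// big1.
Qed.

Lemma eq_iter_bdiff (R : realType) (f g : nat -> R) (k n : nat) :
  f =1 g -> iter k (@bdiff _) f n = iter k (@bdiff _) g n.
Proof. by move=> /funext ->. Qed.

Lemma iter_bdiffB (R : realType) (f g : nat -> R) (k n : nat) :
  iter k (@bdiff _) (fun j => f j - g j) n =
  iter k (@bdiff _) f n - iter k (@bdiff _) g n.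
Proof.
elim: k n => [//|k IHk] n /=; rewrite /bdiff IHk.
by case: n => [|n]; rewrite ?IHk; ring.
Qed.

Lemma horner_reciprocal (R : realType) (p q : {poly R}) (n : nat) (z : R) :
  (forall i, (i <= n)%N -> p`_(n - i) = q`_i) ->
  (forall i, (n < i)%N -> p`_i = 0) -> (forall i, (n < i)%N -> q`_i = 0) ->
  z != 0 -> z ^+ n * p.[z^-1] = q.[z].
Proof.
move=> pq p0 q0 z0.
have sz (r : {poly R}) : (forall i, (n < i)%N -> r`_i = 0) -> (size r <= n.+1)%N.
  by move=> r0; apply/leq_sizeP => i; exact: r0.
rewrite (horner_coef_wide _ (sz p p0)) (horner_coef_wide _ (sz q q0)).
rewrite mulr_sumr (reindex_inj rev_ord_inj)/=; apply: eq_bigr => i _.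
have ein : (i <= n)%N by rewrite -ltnS.
rewrite subSS pq// mulrCA; congr (_ * _).
by rewrite -{1}(subnK ein) exprD mulrAC exprVn mulfV ?mul1r// expf_neq0.
Qed.

(** Substituting [1/z] exchanges [h] and [hs], so it changes the sign of [hs - h]; the factor
    [1 - z] absorbs that sign and one power of [z], which leaves the symmetry of [b]. That of
    [h + b] follows from [h + b = hs + z b]. *)
Lemma reciprocal_decomposition (R : realType) (d : nat) (h hs b : {poly R}) :
  (forall i, (i <= d.+1)%N -> h`_(d.+1 - i) = hs`_i) ->
  (forall i, (d.+1 < i)%N -> h`_i = 0) -> (forall i, (d.+1 < i)%N -> hs`_i = 0) ->
  (1 - 'X) * b = hs - h ->
  forall z : R, z != 0 ->
    (h + b).[z] = z ^+ d.+1 * (h + b).[z^-1] /\ b.[z] = z ^+ d * b.[z^-1].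
Proof.
move=> hhs h0 hs0 bE z z0.
have hz : z ^+ d.+1 * h.[z^-1] = hs.[z] by exact: horner_reciprocal.
have hsz : z ^+ d.+1 * hs.[z^-1] = h.[z].
  apply: horner_reciprocal => // i id.
  by rewrite -hhs ?leq_subr// subKn.
have bz y : (1 - y) * b.[y] = hs.[y] - h.[y].
  by rewrite -hornerN -hornerD -bE !hornerE.
have bsym : b.[z] = z ^+ d * b.[z^-1].
  (* The factor [z - 1] cannot be cancelled at [z = 1], where the identity is trivial. *)
  have [->|z1] := eqVneq z 1; first by rewrite invr1 expr1n mul1r.
  apply: (@mulfI _ (z - 1)); first by rewrite subr_eq0.
  have -> : (z - 1) * b.[z] = - (hs.[z] - h.[z]) by rewrite -bz; ring.
  rewrite -hz -hsz opprB -mulrBr -bz exprS.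
  by field.
split=> //; rewrite !hornerD mulrDr hz exprS -mulrA -bsym.
by have := bz z; move=> /eqP; rewrite mulrBl mul1r; move/eqP => H; lra.
Qed.

(** * Bases and linear programs *)

(** Coefficient vectors keep all [m] entries and a basis is a set of row indices, so that
    coordinates in different bases live in one space and can be compared. *)
Definition supported (R : realType) (m : nat) (B : {set 'I_m}) (l : 'rV[R]_m) :=
  forall i, i \notin B -> l 0 i = 0.

Definition indep (R : realType) (m k : nat) (W : 'M[R]_(m, k)) (B : {set 'I_m}) :=
  forall l, supported B l -> l *m W = 0 -> l = 0.

Definition sel (R : realType) (m : nat) (B : {set 'I_m}) : 'M[R]_m :=
  diag_mx (\row_i (i \in B)%:R).

(** For a basis [B], [x *m bcoord W B] is the coordinate vector of [x]. The final [sel] makes it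
    supported in [B] for every [B]. *)
Definition bcoord (R : realType) (m k : nat) (W : 'M[R]_(m, k)) (B : {set 'I_m}) :
    'M[R]_(k, m) :=
  pinvmx (sel R B *m W) *m sel R B.

Definition basis (R : realType) (m k : nat) (W : 'M[R]_(m, k)) (B : {set 'I_m}) :=
  indep W B /\ row_full (sel R B *m W).

Section Bases.
Variables (R : realType) (m k : nat) (W : 'M[R]_(m, k)).
Implicit Types (A B : {set 'I_m}) (l : 'rV[R]_m) (x y : 'rV[R]_k).

Lemma mul_selE B l i : (l *m sel R B) 0 i = l 0 i * (i \in B)%:R.
Proof. by rewrite mul_mx_diag !mxE. Qed.

Lemma supported_sel B l : supported B (l *m sel R B).
Proof. by move=> i iB; rewrite mul_selE (negPf iB) mulr0. Qed.

Lemma mul_sel_id B l : supported B l -> l *m sel R B = l.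
Proof.
move=> lB; apply/rowP => i; rewrite mul_selE.
by case: (boolP (i \in B)) => iB; rewrite ?mulr1// mulr0 lB.
Qed.

Lemma supported_delta B i : i \in B -> supported B (delta_mx 0 i : 'rV[R]_m).
Proof.
by move=> iB j jB; rewrite mxE/=; case: eqP jB => // ->; rewrite iB.
Qed.

Lemma supportedD B l l' : supported B l -> supported B l' -> supported B (l + l').
Proof. by move=> lB l'B i iB; rewrite mxE lB// l'B// addr0. Qed.

Lemma supportedB B l l' : supported B l -> supported B l' -> supported B (l - l').
Proof. by move=> lB l'B i iB; rewrite !mxE lB// l'B// subr0. Qed.

Lemma supported_bcoord B x : supported B (x *m bcoord W B).
Proof. by rewrite mulmxA; exact: supported_sel. Qed.

Lemma bcoordK B : basis W B -> bcoord W B *m W = 1%:M.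
Proof.
move=> [_ Bfull]; rewrite /bcoord -mulmxA.
by have /mulmxKpV := etrans (sub1mx _) Bfull; rewrite mul1mx.
Qed.

Lemma mulmx_bcoordK B x : basis W B -> x *m bcoord W B *m W = x.
Proof. by move=> bB; rewrite -mulmxA bcoordK// mulmx1. Qed.

Lemma supported_bcoordK B l : basis W B -> supported B l ->
  l *m W *m bcoord W B = l.
Proof.
move=> bB lB; apply/subr0_eq/(proj1 bB).
  by apply: supportedB => //; exact: supported_bcoord.
by rewrite mulmxBl mulmx_bcoordK// subrr.
Qed.

(* Both sides are the trace of [sel B *m W *m bcoord W B = sel B]. *)
Lemma card_basis B : basis W B -> #|B| = k.
Proof.
move=> bB.
have selE : sel R B *m W *m bcoord W B = sel R B.
  apply/row_matrixP => i; rewrite !row_mul supported_bcoordK//.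
  move=> j jB; rewrite !mxE; case: eqP => [->|_]; last by rewrite mulr0n.
  by rewrite (negPf jB).
have bcoord_sel : bcoord W B *m sel R B = bcoord W B.
  by apply/row_matrixP => i; rewrite row_mul mul_sel_id// rowE; exact: supported_bcoord.
apply/eqP; rewrite -(eqr_nat R) -[k%:R](mxtrace1 R) -(bcoordK bB).
rewrite -bcoord_sel -mulmxA -mxtrace_mulC selE mxtrace_diag.
rewrite -sum1_card big_mkcond natr_sum; apply/eqP/eq_bigr => i _.
by rewrite mxE; case: (i \in B).
Qed.

Lemma supported_submx B l : supported B l -> (l *m W <= sel R B *m W)%MS.
Proof. by move=> lB; rewrite -(mul_sel_id lB) -mulmxA submxMl. Qed.

(** A maximal independent [B] containing [A] spans: for [j] outside [B], adding [j] creates a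
    relation, whose coefficient at [j] is nonzero by independence of [B], and it can be solved for
    row [j]. *)
Lemma indep_basis A : row_full W -> indep W A ->
  exists2 B, basis W B & A \subset B.
Proof.
move=> Wfull /asboolP Aindep.
have [B /maxsetP[/asboolP Bindep Bmax] AB] :=
  maxset_exists (P := fun B => `[<indep W B>]) Aindep.
exists B => //; split=> //; rewrite -sub1mx.
apply: (submx_trans (B := W)); first by rewrite sub1mx.
apply/row_subP => j.
have [jB|jB] := boolP (j \in B).
  by rewrite rowE; apply: supported_submx; exact: supported_delta.
have /existsNP[l] : ~ indep W (j |: B).
  move=> /asboolP /Bmax -/(_ (finset.subsetUr _ _)) E.
  by move: jB; rewrite -E setU11.
move=> /not_implyP[lB /not_implyP[lW l0]].
have lj0 : l 0 j != 0.
  apply/eqP => lj0; apply: l0; apply: Bindep => // i iB.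
  have [->//|ij] := eqVneq i j.
  by apply: lB; rewrite in_setU1 negb_or ij.
pose l' := l - l 0 j *: delta_mx 0 j.
have l'B : supported B l'.
  move=> i iB; rewrite !mxE eqxx/=.
  have [->|ij] := eqVneq i j; first by rewrite mulr1 subrr.
  by rewrite mulr0 subr0 lB// in_setU1 negb_or ij.
have : row j W = (- (l 0 j)^-1) *: (l' *m W).
  rewrite rowE mulmxBl lW sub0r scalerN scaleNr opprK -scalemxAl.
  by rewrite scalerA mulVf// scale1r.
by move=> ->; apply: scalemx_sub; exact: supported_submx.
Qed.

End Bases.

(** The reduced costs of the simplex method: the cost of each generator minus the cost of its
    expression in the basis [B]. *)
Definition redcost (R : realType) (m k : nat) (W : 'M[R]_(m, k)) (om : 'cV[R]_m)
    (B : {set 'I_m}) : 'cV[R]_m :=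
  om - W *m (bcoord W B *m om).

Definition dual_feasible (R : realType) (m k : nat) (W : 'M[R]_(m, k))
    (om : 'cV[R]_m) (B : {set 'I_m}) :=
  forall j, 0 <= redcost W om B j 0.

Definition cone (R : realType) (m k : nat) (W : 'M[R]_(m, k)) (x : 'rV[R]_k) :=
  exists2 l : 'rV[R]_m, (forall i, 0 <= l 0 i) & x = l *m W.

(* Positivity of [a + t * b] for all small [t > 0]. *)
Definition lexpos (R : realType) (a b : R) := (0 < a) || (a == 0) && (0 < b).

Lemma near_lexpos (R : realType) (a b : R) : b != 0 ->
  \forall t \near 0^'+, (a + t * b != 0) /\ (0 < a + t * b) = lexpos a b.
Proof.
move=> b0; rewrite /lexpos; have [->|a0] := eqVneq a 0.
  near=> t; have t0 : 0 < t by near: t; exact: nbhs_right_gt.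
  by rewrite add0r mulf_eq0 (gt_eqF t0) (negPf b0) ltxx pmulr_rgt0.
near=> t; have t0 : 0 < t by near: t; exact: nbhs_right_gt.
have : `|t * b| < `|a|.
  rewrite normrM (gtr0_norm t0) -ltr_pdivlMr ?normr_gt0//.
  by near: t; apply: nbhs_right_lt; rewrite divr_gt0 ?normr_gt0.
rewrite /= orbF; move: (a0); rewrite neq_lt => /orP[an|ap].
  rewrite (ltr0_norm an) ltr_norml => /andP[_ ?]; split; first by rewrite lt_eqF//; lra.
  by rewrite (lt_gtF an); apply/negbTE; rewrite -leNgt; lra.
rewrite (gtr0_norm ap) ltr_norml => /andP[? _]; split; first by rewrite gt_eqF//; lra.
by rewrite ap; lra.
Unshelve. all: by end_near. Qed.

Lemma right_nearP (R : realType) (Q : R -> Prop) :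
  (\forall t \near 0^'+, Q t) -> exists2 t : R, 0 < t & Q t.
Proof.
move=> nQ; have : \forall t \near 0^'+, 0 < t /\ Q t.
  by near=> t; split; near: t => //; exact: nbhs_right_gt.
by move=> /filter_ex[t [t0 Qt]]; exists t.
Unshelve. all: by end_near. Qed.

Lemma near_perturb_ge0 (R : realType) (m : nat) (l c : 'rV[R]_m) :
  (forall i, 0 < l 0 i \/ l 0 i = 0 /\ 0 <= c 0 i) ->
  \forall t \near 0^'+, forall i, 0 <= (l + t *: c) 0 i.
Proof.
move=> lc; apply: filter_forall => i.
have [c0|c0] := eqVneq (c 0 i) 0.
  near=> t; rewrite !mxE c0 mulr0 addr0.
  by case: (lc i) => [/ltW //|[-> _]].
near=> t.
have [_] : l 0 i + t * c 0 i != 0 /\ (0 < l 0 i + t * c 0 i) = lexpos (l 0 i) (c 0 i).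
  by near: t; exact: near_lexpos.
rewrite !mxE; suff -> : lexpos (l 0 i) (c 0 i) by move=> /ltW.
rewrite /lexpos; case: (lc i) => [-> //|[-> ci]].
by rewrite eqxx [0 < c 0 i]lt_def c0 ci orbT.
Unshelve. all: by end_near. Qed.

Section LinearProgram.
Variables (R : realType) (m k : nat) (W : 'M[R]_(m, k)).
Implicit Types (B : {set 'I_m}) (l : 'rV[R]_m) (x y : 'rV[R]_k) (om : 'cV[R]_m).

Lemma mulmx_col_ge0 l om : (forall i, 0 <= l 0 i) -> (forall i, 0 <= om i 0) ->
  0 <= (l *m om) 0 0.
Proof. by move=> l0 om0; rewrite mxE sumr_ge0// => i _; rewrite mulr_ge0. Qed.

Lemma cost_redcost B om l :
  l *m om = l *m redcost W om B + l *m W *m bcoord W B *m om.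
Proof. by rewrite /redcost mulmxBr !mulmxA subrK. Qed.

Lemma redcost_basis B om i : basis W B -> i \in B -> redcost W om B i 0 = 0.
Proof.
move=> bB iB; have dB := supported_delta R iB.
have -> : redcost W om B i 0 = ((delta_mx 0 i : 'rV_m) *m redcost W om B) 0 0.
  by rewrite -rowE [RHS]mxE.
have := cost_redcost B om (delta_mx 0 i).
by rewrite supported_bcoordK// -[LHS]add0r => /addIr <-; rewrite mxE.
Qed.

(** Weak duality: by [cost_redcost], the excess of the cost of [l] is its pairing with the
    nonnegative reduced costs. *)
Lemma dual_feasible_min B om l : dual_feasible W om B -> (forall i, 0 <= l 0 i) ->
  (l *m W *m bcoord W B *m om) 0 0 <= (l *m om) 0 0.
Proof.
move=> df l0; rewrite (cost_redcost B om l) [leRHS]mxE lerDr.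
exact: mulmx_col_ge0.
Qed.

Lemma bcoord_ge0 B x : (forall i, i \in B -> 0 < (x *m bcoord W B) 0 i) ->
  forall i, 0 <= (x *m bcoord W B) 0 i.
Proof.
move=> xB i; have [/xB /ltW //|iB] := boolP (i \in B).
by rewrite supported_bcoord.
Qed.

(* Complementary slackness. *)
Lemma optimal_basis_sub om B B' x : 
  (forall j, j \notin B -> redcost W om B j 0 != 0) ->
  basis W B -> basis W B' -> dual_feasible W om B -> dual_feasible W om B' ->
  (forall i, i \in B -> 0 < (x *m bcoord W B) 0 i) ->
  (forall i, i \in B' -> 0 < (x *m bcoord W B') 0 i) -> B' \subset B.
Proof.
move=> gen bB bB' df df' xB xB'; apply/fintype.subsetP => j jB'.
apply: contraT => jB; set l' := x *m bcoord W B'.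
have l'0 : forall i, 0 <= l' 0 i by exact: bcoord_ge0.
(* An index [j] of [B'] outside [B] carries a positive coefficient and a positive reduced cost for
   [B], so the solution on [B'] would cost more than the one on [B], against its own minimality. *)
have := dual_feasible_min df' (bcoord_ge0 xB).
rewrite mulmx_bcoordK// (cost_redcost B om (x *m bcoord W B')) mulmx_bcoordK//.
rewrite [leLHS]mxE gerDr mxE => le0.
suff : 0 < \sum_j0 l' 0 j0 * redcost W om B j0 0 by rewrite ltNge le0.
rewrite (bigD1 j)//= ltr_wpDr//.
  by apply: sumr_ge0 => i _; rewrite mulr_ge0.
by rewrite mulr_gt0 ?xB'// lt_def gen//= df.
Qed.

Definition supp l : {set 'I_m} := [set i | l 0 i != 0].

Lemma supported_supp l : supported (supp l) l.
Proof. by move=> i; rewrite inE negbK => /eqP. Qed.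

Lemma supportedP B l : supported B l -> supp l \subset B.
Proof.
move=> lB; apply/fintype.subsetP => i; rewrite inE; apply: contraR => /lB ->.
exact: eqxx.
Qed.

(** Carathéodory's argument: as long as the support is dependent, a multiple of a relation is
    subtracted until an entry of [l] vanishes. The sign of the relation is chosen so that the cost
    does not increase. *)
Lemma indep_reduction om l : (forall i, 0 < om i 0) -> (forall i, 0 <= l 0 i) ->
  exists l', [/\ forall i, 0 <= l' 0 i, l' *m W = l *m W, indep W (supp l')
    & (l' *m om) 0 0 <= (l *m om) 0 0].
Proof.
move=> om0; move: {2}#|_|.+1 (ltnSn #|supp l|) => n.
elim: n l => // n IHn l ln l0.
have [il|] := pselect (indep W (supp l)); first by exists l.
move=> /existsNP[c0 /not_implyP[c0l /not_implyP[c0W c00]]].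
have [c [cl cW cn0 c_cost]] : exists c, [/\ supported (supp l) c, c *m W = 0,
    c != 0 & 0 <= (c *m om) 0 0].
  have [c0om|/ltW c0om] := leP 0 ((c0 *m om) 0 0); first by exists c0; split=> //; apply/eqP.
  exists (- c0); split; rewrite ?mulNmx ?c0W ?oppr0 ?oppr_eq0//; last 2 first.
  - exact/eqP.
  - by rewrite mxE oppr_ge0.
  by move=> i il; rewrite mxE c0l// oppr0.
(* With positive costs, a nonzero relation of nonnegative cost cannot have all its entries
   nonpositive. *)
have [i0 ci0] : exists i, 0 < c 0 i.
  apply/not_existsP => cle0; move: c_cost; rewrite leNgt => /negP; apply.
  have {}cle0 i : c 0 i <= 0 by rewrite leNgt; apply/negP/cle0.
  have [i ci] : exists i, c 0 i != 0 by apply/rV0Pn; rewrite cn0.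
  rewrite mxE (bigD1 i)//= ltr_nwDl//.
    by rewrite pmulr_llt0// lt_def eq_sym ci cle0.
  by apply: sumr_le0 => j _; rewrite pmulr_lle0.
(* The ratio test: the least quotient is the largest step that keeps every entry nonnegative, and it
   makes entry [i] vanish. *)
have := @arg_minP _ _ _ i0 (fun i => 0 < c 0 i) (fun i => l 0 i / c 0 i) ci0.
case=> i ci imin; set t := l 0 i / c 0 i in imin *.
have t0 : 0 <= t by rewrite divr_ge0// ltW.
pose l1 := l - t *: c.
have l1W : l1 *m W = l *m W by rewrite mulmxBl -scalemxAl cW scaler0 subr0.
have l10 j : 0 <= l1 0 j.
  rewrite !mxE subr_ge0; have [cj|cj] := ltP 0 (c 0 j).
    by rewrite -ler_pdivlMr//; exact: imin.
  by apply: le_trans (l0 j); rewrite mulr_ge0_le0.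
have l1i : l1 0 i = 0 by rewrite !mxE /t divfK ?subrr// gt_eqF.
have il : i \in supp l.
  by apply: contraT => /cl cI; rewrite cI ltxx in ci.
have l1s : supp l1 \subset supp l :\ i.
  apply: supportedP => j; rewrite in_setD1 negb_and negbK => /predU1P[->//|jl].
  by rewrite !mxE (supported_supp jl) cl// mulr0 subr0.
have [] := IHn l1 => //.
  rewrite -ltnS (leq_trans _ ln)// ltnS [in leqRHS](cardsD1 i) il add1n ltnS.
  exact: subset_leq_card.
move=> l' [l'0 l'W il' l'om]; exists l'; split=> //; first by rewrite l'W.
apply: (le_trans l'om); rewrite mulmxBl -scalemxAl !mxE.
have : 0 <= t * (c *m om) 0 0 by rewrite mulr_ge0.
by rewrite !mxE; lra.
Qed.

Lemma cone_basis om x l : row_full W -> (forall i, 0 < om i 0) ->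
  (forall i, 0 <= l 0 i) -> x = l *m W ->
  exists B, [/\ basis W B, forall i, 0 <= (x *m bcoord W B) 0 i
    & (x *m bcoord W B *m om) 0 0 <= (l *m om) 0 0].
Proof.
move=> Wfull om0 l0 ->.
have [l' [l'0 <- il' l'om]] := indep_reduction om0 l0.
have [B bB sB] := indep_basis Wfull il'.
have l'B : supported B l'.
  by move=> i iB; apply: supported_supp; apply: contra iB => /(fintype.subsetP sB).
by exists B; rewrite !supported_bcoordK.
Qed.

(** The cheapest feasible basis is dual feasible: a negative reduced cost would allow a pivot to a
    cheaper one. Nondegeneracy of [x] lets the pivot have positive length. *)
Lemma optimal_basis_exists om x : row_full W -> (forall i, 0 < om i 0) -> cone W x ->
  (forall B i, basis W B -> i \in B -> (x *m bcoord W B) 0 i != 0) ->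
  exists B, [/\ basis W B, dual_feasible W om B
    & forall i, i \in B -> 0 < (x *m bcoord W B) 0 i].
Proof.
move=> Wfull om0 [l l0 xl] nd.
pose F B := `[<basis W B /\ forall i, 0 <= (x *m bcoord W B) 0 i>].
have [B0 [bB0 B00 _]] := cone_basis Wfull om0 l0 xl.
have FB0 : F B0 by apply/asboolP.
have := @arg_minP _ _ _ B0 F (fun B => (x *m bcoord W B *m om) 0 0) FB0.
case=> B /asboolP[bB xB0] Bmin.
have xB i : i \in B -> 0 < (x *m bcoord W B) 0 i.
  by move=> iB; rewrite lt_def xB0 andbT; exact: nd.
exists B; split=> // j; rewrite leNgt; apply/negP => rj.
have jB : j \notin B by apply/negP => jB; rewrite redcost_basis// ltxx in rj.
(* The pivot direction: generator [j] enters, compensated by the basis; its cost is the reduced cost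
   of [j]. *)
pose c : 'rV[R]_m := delta_mx 0 j - delta_mx 0 j *m W *m bcoord W B.
have cW : c *m W = 0 by rewrite mulmxBl mulmx_bcoordK// subrr.
have com : (c *m om) 0 0 = redcost W om B j 0.
  by rewrite /redcost mulmxBl -!mulmxA -mulmxBr -rowE [LHS]mxE.
have [t t0 lt0] : exists2 t : R, 0 < t & forall i, 0 <= (x *m bcoord W B + t *: c) 0 i.
  apply: right_nearP; apply: near_perturb_ge0 => i.
  have [iB|iB] := boolP (i \in B); first by left; exact: xB.
  right; split; first exact: supported_bcoord.
  by rewrite [c 0 i]mxE [X in _ + X]mxE supported_bcoord// subr0 mxE ler0n.
have [|B' [bB' xB' B'om]] := cone_basis (x := x) Wfull om0 lt0.
  by rewrite mulmxDl mulmx_bcoordK// -scalemxAl cW scaler0 addr0.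
have /Bmin : F B' by apply/asboolP.
apply/negP; rewrite -ltNge; apply: le_lt_trans B'om _.
rewrite mulmxDl [ltLHS]mxE -ltrBrDl subrr -scalemxAl mxE com.
by rewrite pmulr_rlt0.
Qed.

Lemma near_lexpos_bcoord (p y : 'rV[R]_k) :
  (forall B i, basis W B -> i \in B -> (p *m bcoord W B) 0 i != 0) ->
  \forall t \near 0^'+, forall B i, basis W B -> i \in B ->
    ((y + t *: p) *m bcoord W B) 0 i != 0 /\
    (0 < ((y + t *: p) *m bcoord W B) 0 i) =
      lexpos ((y *m bcoord W B) 0 i) ((p *m bcoord W B) 0 i).
Proof.
move=> gen; apply: filter_forall => B; apply: filter_forall => i.
have [[bB iB]|nB] := pselect (basis W B /\ i \in B); last first.
  by apply: nearW => t bB iB; case: nB.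
have := near_lexpos ((y *m bcoord W B) 0 i) (gen _ _ bB iB).
apply: filterS => t H _ _; rewrite mulmxDl -scalemxAl.
by rewrite [((y *m bcoord W B) + _) 0 i]mxE [(t *: (p *m bcoord W B)) 0 i]mxE.
Qed.

(** The point [y] may lie on faces of several simplicial cones, but [y + t *: p] is nondegenerate
    for all small [t > 0], and [lexpos] records the signs of its coordinates. *)
Lemma lexpos_basis_exists om (p y : 'rV[R]_k) :
  row_full W -> (forall i, 0 < om i 0) ->
  (forall B i, basis W B -> i \in B -> (p *m bcoord W B) 0 i != 0) ->
  (\forall t \near 0^'+, cone W (y + t *: p)) ->
  exists B, [/\ basis W B, dual_feasible W om B
    & forall i, i \in B -> lexpos ((y *m bcoord W B) 0 i) ((p *m bcoord W B) 0 i)].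
Proof.
move=> Wfull om0 gen yp.
have [t t0 [ypt H]] := right_nearP (filterI yp (near_lexpos_bcoord y gen)).
have [|B [bB df xB]] := @optimal_basis_exists om (y + t *: p) Wfull om0 ypt.
  by move=> B i bB iB; case: (H B i bB iB).
by exists B; split=> // i iB; rewrite -(proj2 (H B i bB iB)) xB.
Qed.

(** At one common small [t], the point [y + t *: p] has positive coordinates in both bases, so
    complementary slackness gives both inclusions. *)
Lemma lexpos_basis_unique om (p y : 'rV[R]_k) B B' :
  (forall B j, basis W B -> j \notin B -> redcost W om B j 0 != 0) ->
  (forall B i, basis W B -> i \in B -> (p *m bcoord W B) 0 i != 0) ->
  basis W B -> basis W B' -> dual_feasible W om B -> dual_feasible W om B' ->
  (forall i, i \in B -> lexpos ((y *m bcoord W B) 0 i) ((p *m bcoord W B) 0 i)) ->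
  (forall i, i \in B' -> lexpos ((y *m bcoord W B') 0 i) ((p *m bcoord W B') 0 i)) ->
  B = B'.
Proof.
move=> genom genp bB bB' df df' yB yB'.
have [t t0 H] := right_nearP (near_lexpos_bcoord y genp).
have pB i : i \in B -> 0 < ((y + t *: p) *m bcoord W B) 0 i.
  by move=> iB; rewrite (proj2 (H B i bB iB)) yB.
have pB' i : i \in B' -> 0 < ((y + t *: p) *m bcoord W B') 0 i.
  by move=> iB; rewrite (proj2 (H B' i bB' iB)) yB'.
apply/eqP; rewrite finset.eqEsubset; apply/andP; split.
  by apply: (optimal_basis_sub _ bB' bB df' df pB' pB) => j; exact: genom.
by apply: (optimal_basis_sub _ bB bB' df df' pB pB') => j; exact: genom.
Qed.

End LinearProgram.

(** * Generic costs and directions by polynomial perturbation *)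

Lemma near_poly_sign (R : realType) (p : {poly R}) : p != 0 ->
  \forall t \near 0^'+, p.[t] != 0 /\ (p.[0] < 0 -> p.[t] < 0).
Proof.
move=> p0; have cont (q : {poly R}) : q.[t] @[t --> 0^'+] --> q.[0].
  by apply: cvg_at_right_filter; exact: continuous_horner.
(* Writing [p] as a power of ['X] times a [q] with [q.[0] != 0], neither factor vanishes at small
   [t > 0]. *)
have [n [q /implyP/(_ p0) q0 pE]] := multiplicity_XsubC p 0.
have nz : \forall t \near 0^'+, q.[t] != 0.
  exact: cvgr_neq0 (cont q) q0.
have neg : \forall t \near 0^'+, p.[0] < 0 -> p.[t] < 0.
  have [p00|_] := ltP p.[0] 0; last exact: nearW.
  by apply: filterS (cvgr_lt _ (cont p) _ p00) => t.
near=> t; have t0 : 0 < t by near: t; exact: nbhs_right_gt.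
split; last by near: t.
rewrite pE hornerM horner_exp !hornerE subr0 mulf_neq0//; first by near: t.
by rewrite expf_neq0// gt_eqF.
Unshelve. all: by end_near. Qed.

Section Genericity.
Variables (R : realType) (m k : nat) (W : 'M[R]_(m, k)).
Implicit Types (B : {set 'I_m}).

Lemma mulmx_bcoord_diag B i : basis W B -> (W *m bcoord W B) i i = (i \in B)%:R.
Proof.
move=> bB; have -> : (W *m bcoord W B) i i = (row i W *m bcoord W B) 0 i.
  by rewrite -row_mul [RHS]mxE.
case: (boolP (i \in B)) => iB; last by rewrite supported_bcoord.
by rewrite rowE supported_bcoordK ?mxE ?eqxx//; exact: supported_delta.
Qed.

(** The cost of generator [i] is [1 + t^(i+1)]. Reduced costs are polynomials in [t], nonzero off
    the basis, hence nonvanishing at small [t > 0]. At [t = 0] the cost is constant, and a reduced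
    cost negative there would stay negative; this gives the last clause, which makes the cost close
    to the height for the boundary. *)
Lemma generic_cost : exists om : 'cV[R]_m, [/\ forall i, 0 < om i 0,
  forall B j, basis W B -> j \notin B -> redcost W om B j 0 != 0
  & forall B, basis W B -> dual_feasible W om B -> dual_feasible W (const_mx 1) B].
Proof.
pose c (i : 'I_m) : {poly R} := 1 + 'X^(i.+1).
pose r B j := c j - \sum_i (W *m bcoord W B) j i *: c i.
pose om t : 'cV[R]_m := \col_i (c i).[t].
have rE B j t : (r B j).[t] = redcost W (om t) B j 0.
  rewrite /redcost mulmxA !mxE hornerD hornerN horner_sum; congr (_ - _).
  by apply: eq_bigr => i _; rewrite hornerZ !mxE.
have om0 : om 0 = const_mx 1.
  by apply/colP => i; rewrite !mxE /c !hornerE expr0n addr0.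
(* The coefficient of degree [j + 1] is 1: row [j] has no [j]-th coordinate in [B], and no other
   generator's cost has this degree. The shift by one keeps clear of the constant term. *)
have r0 B j : basis W B -> j \notin B -> r B j != 0.
  move=> bB jB; apply/eqP => /(congr1 (fun p : {poly R} => p`_j.+1)); apply/eqP.
  rewrite coef0 coefB coef_sum (bigD1 j)//= coefZ mulmx_bcoord_diag// (negPf jB).
  rewrite mul0r add0r big1 ?subr0 ?coefD ?coefXn ?eqxx ?coef1 ?add0r ?oner_eq0//.
  move=> i ij; rewrite coefZ coefD coef1 coefXn add0r eqSS.
  by rewrite -val_eqE eq_sym in ij; rewrite (negPf ij) mulr0.
have [|t t0 H] := @right_nearP R (fun t => forall B j, basis W B -> j \notin B ->
    (r B j).[t] != 0 /\ ((r B j).[0] < 0 -> (r B j).[t] < 0)).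
  apply: filter_forall => B; apply: filter_forall => j.
  have [[bB jB]|nB] := pselect (basis W B /\ j \notin B); last first.
    by apply: nearW => t bB jB; case: nB.
  by have := near_poly_sign (r0 B j bB jB); apply: filterS.
exists (om t); split.
- by move=> i; rewrite mxE /c !hornerE ltr_wpDr// exprn_ge0// ltW.
- by move=> B j bB jB; rewrite -rE; case: (H B j bB jB).
move=> B bB df j; rewrite -om0; have [jB|jB] := boolP (j \in B).
  by rewrite redcost_basis.
rewrite -rE leNgt; apply/negP => /(proj2 (H B j bB jB)).
by rewrite rE ltNge df.
Qed.

(** The weights lie on the moment curve [e^j]. The [i]-th coordinate is a polynomial in [e] whose
    coefficient of degree [i] is 1, since row [i] is its own expression in [B]. *)
Lemma generic_direction : exists2 t : 'rV[R]_m, forall i, 0 < t 0 i &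
  forall B i, basis W B -> i \in B -> (t *m W *m bcoord W B) 0 i != 0.
Proof.
pose r B i := \sum_(j < m) (W *m bcoord W B) j i *: 'X^j.
pose t (e : R) : 'rV[R]_m := \row_j e ^+ j.
have rE B i e : (r B i).[e] = (t e *m W *m bcoord W B) 0 i.
  rewrite -mulmxA [RHS]mxE horner_sum; apply: eq_bigr => j _.
  by rewrite hornerZ hornerXn [t e _ _]mxE mulrC.
have r0 B i : basis W B -> i \in B -> r B i != 0.
  move=> bB iB; apply/eqP => /(congr1 (fun p : {poly R} => p`_i)); apply/eqP.
  rewrite coef0 coef_sum (bigD1 i)//= coefZ mulmx_bcoord_diag// iB mul1r.
  rewrite coefXn eqxx big1 ?addr0 ?oner_eq0// => j ji.
  by rewrite coefZ coefXn -val_eqE eq_sym in ji *; rewrite (negPf ji) mulr0.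
have [|e e0 H] := @right_nearP R (fun e => forall B i, basis W B -> i \in B ->
    (r B i).[e] != 0).
  apply: filter_forall => B; apply: filter_forall => i.
  have [[bB iB]|nB] := pselect (basis W B /\ i \in B); last first.
    by apply: nearW => e bB iB; case: nB.
  by have := near_poly_sign (r0 B i bB iB); apply: filterS => e [].
exists (t e); first by move=> i; rewrite mxE exprn_gt0.
by move=> B i bB iB; rewrite -rE H.
Qed.

End Genericity.

(** * Lattice points of half-open simplices *)

(** Infinite sets get the value 0, hence the finiteness hypotheses below. *)
Definition ncard (T : choiceType) (A : set T) : nat := #|` fset_set A|%fset.

Lemma ncardU (T : choiceType) (A B : set T) : finite_set A -> finite_set B ->
  A `&` B = set0 -> ncard (A `|` B) = (ncard A + ncard B)%N.
Proof.
move=> fA fB AB; rewrite /ncard fset_setU// cardfsU.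
by rewrite -fset_setI// AB fset_set0 cardfs0 subn0.
Qed.

Lemma ncard_image (T U : choiceType) (f : T -> U) (A : set T) : finite_set A ->
  (forall x y, A x -> A y -> f x = f y -> x = y) -> ncard (f @` A) = ncard A.
Proof.
move=> fA finj; rewrite /ncard fset_set_image//; apply/eqP/card_in_imfsetP.
by move=> x y; rewrite !in_fset_set// !inE => Ax Ay; exact: finj.
Qed.

Lemma ncard_involutive (T : choiceType) (f : T -> T) (A B : set T) : finite_set A ->
  involutive f -> (forall x, A x -> B (f x)) -> (forall x, B x -> A (f x)) ->
  ncard A = ncard B.
Proof.
move=> fA fK AB BA; rewrite -(@ncard_image _ _ f A)//; last first.
  by move=> x y _ _; exact: (inv_inj fK).
congr (ncard _); apply/seteqP; split=> [_ [x Ax <-]|x Bx]; first exact: AB.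
by exists (f x); [exact: BA|exact: fK].
Qed.

Lemma ncard_partition (T : choiceType) (I : finType) (P : I -> Prop)
    (A : I -> set T) (Y : set T) : finite_set Y ->
  (forall i y, P i -> A i y -> Y y) -> (forall y, Y y -> exists2 i, P i & A i y) ->
  (forall i j y, P i -> P j -> A i y -> A j y -> i = j) ->
  ncard Y = (\sum_(i | `[<P i>]) ncard (A i))%N.
Proof.
move=> fY AY YA disj.
have -> : ncard Y = (\sum_(y <- fset_set Y) \sum_(i | `[<P i>]) (y \in A i))%N.
  rewrite /ncard -sum1_size big_seq [RHS]big_seq; apply: eq_bigr => y.
  rewrite in_fset_set// inE => /YA[i Pi Aiy].
  rewrite (bigD1 i)/=; last exact/asboolP.
  rewrite mem_set// big1// => j /andP[/asboolP Pj ji].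
  apply/eqP; rewrite eqb0; apply/negP; rewrite inE => Ajy.
  by rewrite (disj _ _ _ Pj Pi Ajy Aiy) eqxx in ji.
rewrite exchange_big/=; apply: eq_bigr => i /asboolP Pi.
have fA : finite_set (A i) by apply: sub_finite_set fY => y; exact: (AY i y Pi).
rewrite -big_mkcond/=.
rewrite sum1_count -size_filter; apply: perm_size; apply: uniq_perm => //.
  by rewrite filter_uniq.
move=> y; rewrite mem_filter !in_fset_set//.
apply/andP/idP => [[]//|yA]; split=> //.
by move: yA; rewrite !inE; exact: (AY i y Pi).
Qed.

Lemma finite_integer_box (R : realType) (d : nat) (K : R) :
  finite_set [set x : 'rV[R]_d | integer_points x /\ forall j, `|x 0 j| <= K].
Proof.
pose N := Num.bound K.
(* Ordinals up to [2N], shifted by [N], enumerate the integers from [-N] to [N]. *)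
pose f (u : 'rV['I_(N + N).+1]_d) : 'rV[R]_d := \row_j ((u 0 j : nat)%:R - N%:R).
apply: (@sub_finite_set _ _ (f @` setT)); last exact/finite_image/finite_finset.
move=> x [xint xK]; have xN j : `|x 0 j| <= N%:R.
  by apply: (le_trans (xK j)); apply: ltW; apply: archi_boundP; apply: le_trans (xK j).
pose fl j : int := Num.floor (x 0 j + N%:R).
exists (\row_j inord `|fl j|%N) => //; apply/rowP => j; rewrite !mxE /fl.
have := xN j; rewrite ler_norml => /andP[xl xu].
have [z zE] : exists z : int, x 0 j + N%:R = z%:~R.
  by have /intrP[z ->] := xint j; exists (z + N%:Z); rewrite intrD.
have z0 : 0 <= z by rewrite -(ler_int R) -zE; lra.
rewrite zE intrKfloor inordK; first by rewrite natr_absz ger0_norm// -zE addrK.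
rewrite ltnS -(ler_nat R) natr_absz ger0_norm// -zE natrD; lra.
Qed.

Lemma integer_pointsD (R : realType) (d : nat) (x y : 'rV[R]_d) :
  integer_points x -> integer_points y -> integer_points (x + y).
Proof. by move=> xi yi j; rewrite mxE; apply: rpredD; [exact: xi|exact: yi]. Qed.

Lemma integer_pointsB (R : realType) (d : nat) (x y : 'rV[R]_d) :
  integer_points x -> integer_points y -> integer_points (x - y).
Proof. by move=> xi yi j; rewrite !mxE; apply: rpredB; [exact: xi|exact: yi]. Qed.

Lemma sum_rowD (R : realType) (m : nat) (l l' : 'rV[R]_m) :
  \sum_i (l + l') 0 i = \sum_i l 0 i + \sum_i l' 0 i.
Proof. by rewrite -big_split; apply: eq_bigr => i _; rewrite mxE. Qed.

Lemma sum_rowB (R : realType) (m : nat) (l l' : 'rV[R]_m) :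
  \sum_i (l - l') 0 i = \sum_i l 0 i - \sum_i l' 0 i.
Proof. by rewrite -sumrB; apply: eq_bigr => i _; rewrite !mxE. Qed.

Lemma sum_rowZ (R : realType) (m : nat) (a : R) (l : 'rV[R]_m) :
  \sum_i (a *: l) 0 i = a * \sum_i l 0 i.
Proof. by rewrite mulr_sumr; apply: eq_bigr => i _; rewrite mxE. Qed.

Lemma sum_delta (R : realType) (m : nat) (i : 'I_m) :
  \sum_j (delta_mx 0 i : 'rV[R]_m) 0 j = 1.
Proof.
by rewrite (bigD1 i)//= mxE !eqxx big1 ?addr0// => j ji; rewrite mxE (negPf ji).
Qed.

Section Points.
Variables (R : realType) (m d : nat) (V : 'M[R]_(m, d)).
Implicit Types (l : 'rV[R]_m) (n : nat).

Definition closed_points n : set 'rV[R]_d :=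
  [set x | integer_points x /\ exists l, [/\ forall i, 0 <= l 0 i,
    x = l *m V & \sum_i l 0 i = n%:R]].

(** For generators of full rank and [n > 0], these are the lattice points in the interior of the
    dilate, by [interior_dilate]. *)
Definition open_points n : set 'rV[R]_d :=
  [set x | integer_points x /\ exists l, [/\ forall i, 0 < l 0 i,
    x = l *m V & \sum_i l 0 i = n%:R]].

Lemma open_points_sub n : open_points n `<=` closed_points n.
Proof.
move=> x [xi [l [l0 lV ls]]]; split=> //; exists l; split=> // i.
exact: ltW.
Qed.

Lemma closed_points_finite n : finite_set (closed_points n).
Proof.
have fK := finite_integer_box d (n%:R * \sum_j \sum_i `|V i j|).
apply: sub_finite_set fK => x [xi [l [l0 xE ls]]]; rewrite xE in xi *.
split=> // j; rewrite mxE (le_trans (ler_norm_sum _ _ _))//.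
have ln i : l 0 i <= n%:R by rewrite -ls (bigD1 i)//= lerDl sumr_ge0.
rewrite (bigD1 j)//= mulrDr ler_wpDr//.
  by rewrite mulr_ge0// sumr_ge0// => k _; exact: sumr_ge0.
rewrite mulr_sumr; apply: ler_sum => i _.
by rewrite normrM ger0_norm// ler_wpM2r.
Qed.

End Points.

Section HalfOpenSimplex.
Variables (R : realType) (m d : nat) (V : 'M[R]_(m, d)).
Hypothesis Vint : forall i, integer_points (row i V).
Implicit Types (B S J : {set 'I_m}) (l : 'rV[R]_m) (n : nat).

(* The coefficient vectors [l] of the lattice points [l *m V] of the [n]-th
   dilate of the simplex [B] whose facets opposite to [S] are removed, subject
   for [i] in [J] to [l i] lying in a half-open unit interval. For [J = B] they
   describe the lattice points of the half-open fundamental parallelepiped. *)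
Definition hbox B S J n : set 'rV[R]_m :=
  [set l | [/\ supported B l, forall i, i \in B -> 0 < l 0 i ?<= if (i \notin S),
    forall i, i \in J -> l 0 i < 1 ?<= if (i \in S),
    integer_points (l *m V) & \sum_i l 0 i = n%:R]].

Lemma hbox_ge0 B S J n l i : hbox B S J n l -> 0 <= l 0 i.
Proof.
case=> lB l0 _ _ _; have [/l0 /lteifW //|/lB ->] := boolP (i \in B).
exact: lexx.
Qed.

Lemma mul_row1 l : l *m row_mx V (const_mx 1 : 'cV_m) = row_mx (l *m V) (\sum_i l 0 i)%:M.
Proof.
rewrite mul_mx_row; congr row_mx; apply/matrixP => i j.
by rewrite !ord1 !mxE eqxx mulr1n; apply: eq_bigr => k _; rewrite mxE mulr1.
Qed.

Lemma finite_hbox B S J n : indep (row_mx V (const_mx 1 : 'cV_m)) B ->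
  finite_set (hbox B S J n).
Proof.
move=> iB.
have inj : {in hbox B S J n &, injective (fun l => l *m V)}.
  move=> l l'; rewrite !inE => -[lB _ _ _ ls] [l'B _ _ _ l's] ll'.
  apply/subr0_eq/iB; first exact: supportedB.
  by rewrite mulmxBl !mul_row1 ll' ls l's subrr.
rewrite -(eq_finite_set (inj_card_eq inj)).
apply: sub_finite_set (closed_points_finite V n) => x [l lH <-].
have [_ _ _ lV ls] := lH; split=> //; exists l; split=> // i.
exact: hbox_ge0 lH.
Qed.

(** Either coefficient [i] lies in the half-open unit interval, or generator [i] can be subtracted
    once, which lowers the height by one. *)
Lemma hbox_recS B S J n i : J \subset B -> i \in B -> i \notin J ->
  hbox B S J n.+1 =
  hbox B S (i |: J) n.+1 `|` [set delta_mx 0 i + l | l in hbox B S J n].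
Proof.
move=> JB iB iJ; have dB := supported_delta R iB.
have dV : delta_mx 0 i *m V = row i V by rewrite rowE.
apply/seteqP; split=> [l [lB l0 l1 lV ls]|l].
  have [li|] := boolP (l 0 i < 1 ?<= if (i \in S)).
    left; split=> // j /setU1P[->//|]; exact: l1.
  rewrite -lteifNE => li; right; exists (l - delta_mx 0 i); last by rewrite addrC subrK.
  split.
  - exact: supportedB.
  - move=> j jB; rewrite !mxE eqxx/=; have [->|ji] := eqVneq j i.
      by rewrite lteifBrDr add0r.
    by rewrite subr0; exact: l0.
  - move=> j jJ; rewrite !mxE eqxx/=; have [ji|ji] := eqVneq j i.
      by rewrite ji (negPf iJ) in jJ.
    by rewrite subr0; exact: l1.
  - by rewrite mulmxBl dV; exact: integer_pointsB.
  by rewrite sum_rowB ls sum_delta -natr1 addrK.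
case=> [[lB l0 l1 lV ls]|[l' [lB l0 l1 lV ls] <-]].
  by split=> // j jJ; apply: l1; rewrite in_setU1 jJ orbT.
split.
- exact: supportedD.
- move=> j jB; rewrite !mxE eqxx/=; have [->|ji] := eqVneq j i.
    by apply: lteifS; rewrite ltr_pwDl ?ltr01//; exact: lteifW (l0 i iB).
  by rewrite add0r; exact: l0.
- move=> j jJ; rewrite !mxE eqxx/=; have [ji|ji] := eqVneq j i.
    by rewrite ji (negPf iJ) in jJ.
  by rewrite add0r; exact: l1.
- by rewrite mulmxDl dV; exact: integer_pointsD.
by rewrite sum_rowD ls sum_delta -natr1 addrC.
Qed.

(** At height 0 every coefficient is at most 0, so the new upper bound holds by itself. *)
Lemma hbox_rec0 B S J i : J \subset B -> i \in B ->
  hbox B S J 0 = hbox B S (i |: J) 0.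
Proof.
move=> JB iB; apply/seteqP; split=> l lH; have [lB l0 l1 lV ls] := lH.
  split=> // j /setU1P[->|]; last exact: l1.
  apply: lteifS; apply: le_lt_trans (@ltr01 R).
  by rewrite -[leRHS](mulr0n 1) -ls (bigD1 i)//= lerDl sumr_ge0// => k _; exact: hbox_ge0 lH.
by split=> // j jJ; apply: l1; rewrite in_setU1 jJ orbT.
Qed.

(** Each factor [1 - z] confines one more coefficient to its unit interval, by [hbox_recS]; for
    [J = B] only the fundamental parallelepiped remains. *)
Lemma iter_bdiff_hbox B S J n : indep (row_mx V (const_mx 1 : 'cV_m)) B -> J \subset B ->
  iter #|J| (@bdiff _) (fun j => (ncard (hbox B S finset.set0 j))%:R : R) n =
  (ncard (hbox B S J n))%:R.
Proof.
move=> iB; move: {2}#|J| (erefl #|J|) => k; elim: k J n => [|k IHk] J n Jk JB.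
  by move/eqP: Jk; rewrite cards_eq0 => /eqP ->; rewrite cards0.
have /card_gt0P[i iJ] : (0 < #|J|)%N by rewrite Jk.
have JE : i |: (J :\ i) = J by exact: finset.setD1K.
have iJ' : i \notin J :\ i by rewrite setD11.
have iB' : i \in B by exact: (fintype.subsetP JB).
have J'B : J :\ i \subset B by apply: fintype.subset_trans JB; exact: subD1set.
have J'k : #|J :\ i| = k by move: Jk; rewrite -{1}JE cardsU1 iJ' => -[].
rewrite Jk iterS /bdiff -J'k IHk// -[in RHS]JE.
case: n => [|n]; first by rewrite subr0 (hbox_rec0 _ J'B iB').
rewrite IHk// (hbox_recS _ _ J'B iB' iJ') ncardU; last first.
(* The two pieces are disjoint: after the translation, coefficient [i] is past its unit interval. *)
- rewrite -subset0 => x [[_ _ l1 _ _] [l [_ l0 _ _ _] lE]].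
  move: (l1 i); rewrite setU11 => /(_ isT); apply/negP; rewrite -lteifNE -lE.
  rewrite !mxE !eqxx/= -[X in X < _ ?<= if _](addr0 1) lteifD2l.
  exact: l0.
- by apply: finite_image; exact: finite_hbox.
- exact: finite_hbox.
rewrite ncard_image ?natrD ?addrK//; first exact: finite_hbox.
by move=> x y _ _ /addrI.
Qed.

(** With [e] the sum of the generators in [B], the map [e - l] exchanges lower and upper bounds,
    hence [S] and its complement. *)
Lemma hbox_reciprocity B S n : indep (row_mx V (const_mx 1 : 'cV_m)) B -> (n <= #|B|)%N ->
  ncard (hbox B S B n) = ncard (hbox B (~: S) B (#|B| - n)).
Proof.
move=> iB nB; pose e : 'rV[R]_m := \row_i (i \in B)%:R.
have eB : supported B e by move=> i iB'; rewrite mxE (negPf iB').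
have eV : integer_points (e *m V).
  move=> j; rewrite mxE; apply: rpred_sum => i _; rewrite mxE.
  by have := Vint i j; rewrite mxE => ?; apply: rpredM => //; exact: natr_int.
have es : \sum_i e 0 i = #|B|%:R.
  rewrite -sum1_card [in RHS]big_mkcond natr_sum; apply: eq_bigr => i _.
  by rewrite mxE; case: (i \in B).
have sub S' k : (k <= #|B|)%N -> forall l, hbox B S' B k l ->
    hbox B (~: S') B (#|B| - k) (e - l).
  move=> kB l [lB l0 l1 lV ls]; split.
  - exact: supportedB.
  - move=> i iB'; rewrite !mxE iB' lteifBrDr add0r finset.in_setC negbK; exact: l1.
  - move=> i iB'; rewrite !mxE iB' lteifBlDr -[X in X < _ ?<= if _]addr0 lteifD2l finset.in_setC.
    exact: l0.
  - by rewrite mulmxBl; exact: integer_pointsB.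
  by rewrite sum_rowB es ls natrB.
apply: (@ncard_involutive _ (fun l => e - l)); first exact: finite_hbox.
- by move=> l; rewrite subKr.
- exact: sub.
by move=> l /sub; rewrite leq_subr subKn// finset.setCK; exact.
Qed.

Lemma ncard_hbox_gt B S n : (#|B| < n)%N -> ncard (hbox B S B n) = 0%N.
Proof.
move=> Bn; rewrite /ncard; suff -> : hbox B S B n = set0.
  by rewrite fset_set0 cardfs0.
rewrite -subset0 => l [lB _ l1 _ ls]; move: Bn; rewrite ltnNge => /negP; apply.
rewrite -(ler_nat R) -ls -sum1_card [in leRHS]big_mkcond natr_sum ler_sum// => i _.
by have [/l1 /lteifW//|/lB ->] := boolP (i \in B).
Qed.

End HalfOpenSimplex.

(** * Half-open decompositions *)

(** Lexicographic positivity is thus one inequality, strict exactly when [b < 0]: this is what makes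
    the cones half-open. *)
Lemma lexposP (R : realType) (a b : R) : b != 0 ->
  lexpos a b = (0 < a ?<= if ~~ (b < 0)).
Proof.
move=> b0; rewrite /lexpos; case: (ltgtP a 0) => [a0|a0|->]; rewrite /=.
- by rewrite lteifNE; apply/esym/negbF/lteifS.
- by apply/esym/lteifS.
by rewrite lteifxx -leNgt lt_def b0.
Qed.

Lemma row_count_gt0 (R : realType) (m d : nat) (V : 'M[R]_(m, d)) :
  row_full (row_mx V (const_mx 1 : 'cV_m)) -> (0 < m)%N.
Proof.
move=> /eqP r; have := rank_leq_row (row_mx V (const_mx 1 : 'cV[R]_m)).
by rewrite r addn1; exact: leq_ltn_trans.
Qed.

Section Decomposition.
Variables (R : realType) (m d : nat) (V : 'M[R]_(m, d)).
Implicit Types (B S J : {set 'I_m}) (l : 'rV[R]_m) (n : nat).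

Let W : 'M[R]_(m, d + 1) := row_mx V (const_mx 1).

Hypothesis Wfull : row_full W.

Definition optimal_basis (k : nat) (U : 'M[R]_(m, k)) (om : 'cV[R]_m) B :=
  basis U B /\ dual_feasible U om B.

(** The facets through which a move along [p] leaves the cone of [B], each named by the opposite
    generator. *)
Definition removed_facets (k : nat) (U : 'M[R]_(m, k)) (p : 'rV[R]_k) B : {set 'I_m} :=
  [set i | (p *m bcoord U B) 0 i < 0].

Lemma lift_mulP (x : 'rV[R]_d) (s : R) l :
  row_mx x s%:M = l *m W <-> x = l *m V /\ \sum_i l 0 i = s.
Proof.
rewrite mul_row1; split=> [/eq_row_mx[-> /matrixP/(_ 0 0)]|[-> ->]//].
by rewrite !mxE eqxx !mulr1n.
Qed.

(* A point lies in the half-open cone of the one basis whose cone contains its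
   translates by small positive multiples of [p]. *)
Lemma ncard_half_open_decomposition (om : 'cV[R]_m) (p : 'rV[R]_(d + 1))
    (X : set 'rV[R]_d) n :
  (forall i, 0 < om i 0) ->
  (forall B j, basis W B -> j \notin B -> redcost W om B j 0 != 0) ->
  (forall B i, basis W B -> i \in B -> (p *m bcoord W B) 0 i != 0) ->
  X `<=` closed_points V n ->
  (forall x, X x <-> integer_points x /\
     \forall t \near 0^'+, cone W (row_mx x n%:R%:M + t *: p)) ->
  ncard X = (\sum_(B : {set 'I_m} | `[<optimal_basis W om B>])
    ncard (hbox V B (removed_facets W p B) finset.set0 n))%N.
Proof.
move=> om0 genom genp Xclosed XP.
pose A B := (fun l => l *m V) @` hbox V B (removed_facets W p B) finset.set0 n.
have lexE B i l : basis W B -> i \in B ->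
    lexpos (l 0 i) ((p *m bcoord W B) 0 i) =
    (0 < l 0 i ?<= if (i \notin removed_facets W p B)).
  by move=> bB iB; rewrite inE -lexposP// genp.
rewrite (@ncard_partition _ _ (optimal_basis W om) A).
- apply: eq_bigr => B /asboolP[bB _]; rewrite ncard_image//.
    exact: finite_hbox (proj1 bB).
  move=> l l' [lB _ _ _ ls] [l'B _ _ _ l's] ll'; apply/subr0_eq/(proj1 bB).
    exact: supportedB.
  by rewrite mulmxBl !mul_row1 ll' ls l's subrr.
- exact: sub_finite_set Xclosed (closed_points_finite V n).
- move=> B _ [bB _] [l [lB l0 _ lV ls] <-]; apply/XP; split=> //.
  have -> : row_mx (l *m V) n%:R%:M = l *m W by apply/lift_mulP.
  have : \forall t \near 0^'+, forall i, 0 <= (l + t *: (p *m bcoord W B)) 0 i.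
    apply: near_perturb_ge0 => i; have [iB|iB] := boolP (i \in B); last first.
      by right; rewrite lB// supported_bcoord.
    have := l0 i iB; rewrite -lexE// /lexpos => /orP[|/andP[/eqP -> /ltW]]; first by left.
    by right.
  apply: filterS => t lt0; exists (l + t *: (p *m bcoord W B)) => //.
  by rewrite mulmxDl -scalemxAl mulmx_bcoordK.
- move=> x /XP[xi xp].
  have [B [bB df xB]] := lexpos_basis_exists Wfull om0 genp xp.
  exists B => //; exists (row_mx x n%:R%:M *m bcoord W B); last first.
    by have /lift_mulP[<-] := esym (mulmx_bcoordK (row_mx x n%:R%:M) bB).
  have /lift_mulP[xE xs] := esym (mulmx_bcoordK (row_mx x n%:R%:M) bB).
  split=> //; first exact: supported_bcoord.
  + by move=> i iB; rewrite -lexE// xB.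
  + by move=> i; rewrite inE.
  + by rewrite -xE.
move=> B B' x [bB df] [bB' df'] [l [lB l0 _ lV ls] lx] [l' [l'B l'0 _ l'V l's] l'x].
have xl : row_mx x n%:R%:M = l *m W by apply/lift_mulP.
have xl' : row_mx x n%:R%:M = l' *m W by apply/lift_mulP.
apply: (lexpos_basis_unique (y := row_mx x n%:R%:M) genom genp) => // i iB.
  by rewrite xl supported_bcoordK// lexE// l0.
by rewrite xl' supported_bcoordK// lexE// l'0.
Qed.

Lemma near_subZ_ge0 l l' : (forall i, 0 < l 0 i) ->
  \forall t \near 0^'+, forall i, 0 <= (l - t *: l') 0 i.
Proof.
move=> l0; have := near_perturb_ge0 (l := l) (c := - l') (fun i => or_introl (l0 i)).
by apply: filterS => t H i; rewrite -scalerN.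
Qed.

Lemma near_gt0 (Q : R -> Prop) : (forall t, 0 < t -> Q t) -> \forall t \near 0^'+, Q t.
Proof.
by move=> H; near=> t; apply: H; near: t; exact: nbhs_right_gt.
Unshelve. all: by end_near. Qed.

(** Adding multiples of the positive combination [tau *m W] never leaves the cone; conversely,
    lexicographically positive coordinates are nonnegative. *)
Lemma closed_points_decomposition (om : 'cV[R]_m) (tau : 'rV[R]_m) n :
  (forall i, 0 < om i 0) ->
  (forall B j, basis W B -> j \notin B -> redcost W om B j 0 != 0) ->
  (forall i, 0 < tau 0 i) ->
  (forall B i, basis W B -> i \in B -> (tau *m W *m bcoord W B) 0 i != 0) ->
  ncard (closed_points V n) = (\sum_(B : {set 'I_m} | `[<optimal_basis W om B>])
    ncard (hbox V B (removed_facets W (tau *m W) B) finset.set0 n))%N.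
Proof.
move=> om0 genom tau0 gent.
apply: (ncard_half_open_decomposition om0 genom gent) => // x; split=> [[xi]|[xi xt]].
  move=> [l [l0 lV ls]]; split=> //; apply: near_gt0 => t t0.
  exists (l + t *: tau); first by move=> i; rewrite !mxE addr_ge0// mulr_ge0// ltW.
  have -> : row_mx x n%:R%:M = l *m W by apply/lift_mulP.
  by rewrite mulmxDl -scalemxAl.
have [B [bB _ xB]] := lexpos_basis_exists Wfull om0 gent xt.
have /lift_mulP[xE xs] := esym (mulmx_bcoordK (row_mx x n%:R%:M) bB).
split=> //; exists (row_mx x n%:R%:M *m bcoord W B); split=> // i.
have [iB|iB] := boolP (i \in B); last by rewrite supported_bcoord.
by have := xB i iB; rewrite lexposP ?gent// => /lteifW.
Qed.

(** All-positive coefficients survive the subtraction of a small multiple of [tau]; conversely,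
    adding that multiple back makes nonnegative coefficients positive. *)
Lemma open_points_decomposition (om : 'cV[R]_m) (tau : 'rV[R]_m) n :
  (forall i, 0 < om i 0) ->
  (forall B j, basis W B -> j \notin B -> redcost W om B j 0 != 0) ->
  (forall i, 0 < tau 0 i) ->
  (forall B i, basis W B -> i \in B -> (tau *m W *m bcoord W B) 0 i != 0) ->
  ncard (open_points V n) = (\sum_(B : {set 'I_m} | `[<optimal_basis W om B>])
    ncard (hbox V B (removed_facets W (- (tau *m W)) B) finset.set0 n))%N.
Proof.
move=> om0 genom tau0 gent.
apply: (ncard_half_open_decomposition om0 genom).
- by move=> B i bB iB; rewrite mulNmx mxE oppr_eq0 gent.
- exact: open_points_sub.
move=> x; split=> [[xi [l [l0 lV ls]]]|[xi /right_nearP[t t0 [l l0 xl]]]].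
  split=> //; have -> : row_mx x n%:R%:M = l *m W by apply/lift_mulP.
  apply: filterS (near_subZ_ge0 tau l0) => t lt0.
  by exists (l - t *: tau); rewrite // mulmxBl -scalemxAl scalerN.
split=> //; exists (l + t *: tau).
have /lift_mulP[-> ->] : row_mx x n%:R%:M = (l + t *: tau) *m W.
  by rewrite mulmxDl -xl -scalemxAl scalerN subrK.
by split=> // i; rewrite !mxE ltr_wpDl// mulr_gt0.
Qed.

End Decomposition.

(** * Decomposition of the boundary by projection along an interior direction *)

Section BoundaryDecomposition.
Variables (R : realType) (m d : nat) (V : 'M[R]_(m, d)).
Hypothesis Wfull : row_full (row_mx V (const_mx 1 : 'cV[R]_m)).
Variable tau : 'rV[R]_m.
Hypothesis tau0 : forall i, 0 < tau 0 i.
Implicit Types (B S J : {set 'I_m}) (l : 'rV[R]_m) (n : nat).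

Let s := \sum_i tau 0 i.

(* The interior point from which the boundary is projected. *)
Let c : 'rV[R]_d := s^-1 *: (tau *m V).

(** The images of the lifted generators under [(x, r) |-> x - r c], whose kernel is spanned by
    [(c, 1)], a multiple of the lift of [tau]. *)
Definition centered : 'M[R]_(m, d) := V - (const_mx 1 : 'cV_m) *m c.

Local Notation U := centered.

Lemma weight_gt0 : 0 < s.
Proof.
have m0 := row_count_gt0 Wfull.
rewrite /s (bigD1 (Ordinal m0))//= ltr_pwDl// sumr_ge0// => i _.
exact: ltW.
Qed.

Lemma mul_centered l : l *m U = l *m V - (\sum_i l 0 i) *: c.
Proof.
rewrite mulmxBr mulmxA; congr (_ - _); apply/rowP => j.
rewrite !mxE big_ord1 !mxE; congr (_ * _).
by apply: eq_bigr => i _; rewrite mxE mulr1.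
Qed.

Lemma tau_centered : tau *m U = 0.
Proof.
by rewrite mul_centered /c scalerA mulfV ?scale1r ?subrr// gt_eqF// weight_gt0.
Qed.

Lemma coefficients_exist (x : 'rV[R]_d) (r : R) :
  exists l, x = l *m V /\ \sum_i l 0 i = r.
Proof.
have /submxP[l xl] : (row_mx x (r%:M : 'M[R]_1) <= row_mx V (const_mx 1 : 'cV[R]_m))%MS.
  exact: submx_full.
by exists l; apply/lift_mulP.
Qed.

Lemma centered_full : row_full U.
Proof.
rewrite -sub1mx; apply/row_subP => j.
have [l [-> l0]] := coefficients_exist (row j 1%:M) 0.
by rewrite (_ : l *m V = l *m U) ?submxMl// mul_centered l0 scale0r subr0.
Qed.

(** Since [tau] is a relation with positive coefficients, a large multiple of it makes any
    coefficient vector nonnegative without moving the point. *)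
Lemma cone_centered (x : 'rV[R]_d) : cone U x.
Proof.
have [l [-> ls]] := coefficients_exist x 0.
have K0 : 0 <= \sum_i (`|l 0 i| / tau 0 i).
  by apply: sumr_ge0 => i _; rewrite divr_ge0// ltW.
exists (l + (\sum_i (`|l 0 i| / tau 0 i)) *: tau); last first.
  by rewrite mulmxDl -scalemxAl tau_centered scaler0 addr0 mul_centered ls scale0r subr0.
move=> i; rewrite !mxE; suff : - l 0 i <= (\sum_i (`|l 0 i| / tau 0 i)) * tau 0 i by lra.
rewrite -ler_pdivrMr// (bigD1 i)//= ler_wpDr//.
  by apply: sumr_ge0 => j _; rewrite divr_ge0// ltW.
by rewrite ler_pM2r ?invr_gt0// -normrN ler_norm.
Qed.

Lemma indep_centered B : indep U B -> indep (row_mx V (const_mx 1 : 'cV_m)) B.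
Proof.
move=> iB l lB lW; apply: iB => //.
have /lift_mulP[lV ls] : row_mx 0 (0%:M : 'M[R]_1) = l *m row_mx V (const_mx 1 : 'cV_m).
  by rewrite lW raddf0 row_mx0.
by rewrite mul_centered -lV ls scale0r subr0.
Qed.

(** Weak duality for the constant cost 1, whose value is the height: coordinates in such a basis
    give the lowest point of the cone above a given projection. *)
Lemma centered_min B l l' : basis U B -> dual_feasible U (const_mx 1) B ->
  supported B l -> (forall i, 0 <= l' 0 i) -> l' *m U = l *m U ->
  \sum_i l 0 i <= \sum_i l' 0 i.
Proof.
move=> bB df lB l'0 l'l; have := dual_feasible_min df l'0.
have sumE (k : 'rV[R]_m) : (k *m (const_mx 1 : 'cV_m)) 0 0 = \sum_i k 0 i.
  by rewrite mxE; apply: eq_bigr => i _; rewrite mxE mulr1.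
by rewrite l'l supported_bcoordK// !sumE.
Qed.

(** The boundary points are those of least height above their projection, and the optimal bases of
    the projected generators give exactly these. *)
Lemma boundary_decomposition (om : 'cV[R]_m) (p : 'rV[R]_d) n :
  (forall i, 0 < om i 0) ->
  (forall B j, basis U B -> j \notin B -> redcost U om B j 0 != 0) ->
  (forall B, basis U B -> dual_feasible U om B -> dual_feasible U (const_mx 1) B) ->
  (forall B i, basis U B -> i \in B -> (p *m bcoord U B) 0 i != 0) ->
  ncard (closed_points V n `\` open_points V n) =
  (\sum_(B : {set 'I_m} | `[<optimal_basis U om B>])
    ncard (hbox V B (removed_facets U p B) finset.set0 n))%N.
Proof.
move=> om0 genom om1 genp.
pose A B := (fun l => l *m V) @` hbox V B (removed_facets U p B) finset.set0 n.
have lexE B i l : basis U B -> i \in B ->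
    lexpos (l 0 i) ((p *m bcoord U B) 0 i) =
    (0 < l 0 i ?<= if (i \notin removed_facets U p B)).
  by move=> bB iB; rewrite inE -lexposP// genp.
rewrite (@ncard_partition _ _ (optimal_basis U om) A).
- apply: eq_bigr => B /asboolP[bB _]; have iB := indep_centered (proj1 bB).
  rewrite ncard_image//; first exact: finite_hbox.
  move=> l l' [lB _ _ _ ls] [l'B _ _ _ l's] ll'; apply/subr0_eq/iB.
    exact: supportedB.
  by rewrite mulmxBl !mul_row1 ll' ls l's subrr.
- apply: sub_finite_set (closed_points_finite V n); exact: subDsetl.
- move=> B _ [bB df] [l lH <-]; have [lB l0 _ lV ls] := lH; split.
    split=> //; exists l; split=> // i; exact: hbox_ge0 lH.
  move=> [_ [l' [l'0 l'V l's]]].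
  (* An all-positive representation could be lowered by [t *: tau] over the same projection, against
     minimality. *)
  have [t t0 lt0] := right_nearP (near_subZ_ge0 tau l'0).
  have := centered_min bB (om1 B bB df) lB lt0.
  rewrite mulmxBl -scalemxAl tau_centered scaler0 subr0 !mul_centered l'V ls l's.
  move=> /(_ erefl); rewrite sum_rowB l's sum_rowZ -/s.
  by have := mulr_gt0 t0 weight_gt0; lra.
- move=> x [[xi [l [l0 xl ls]]] xo].
  have [B [bB df yB]] := @lexpos_basis_exists _ _ _ _ om p (l *m U) centered_full om0 genp
    (nearW _ (fun t => cone_centered _)).
  set mu := l *m U *m bcoord U B in yB *.
  have muU : mu *m U = l *m U by exact: mulmx_bcoordK.
  have muB : supported B mu by exact: supported_bcoord.
  have mu0 i : 0 <= mu 0 i.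
    have [iB|iB] := boolP (i \in B); last by rewrite muB.
    by have := yB i iB; rewrite lexE// => /lteifW.
  have muV : mu *m V = x + (\sum_i mu 0 i - n%:R) *: c.
    move: muU; rewrite !mul_centered ls -xl => /eqP.
    by rewrite subr_eq => /eqP ->; rewrite scalerBl addrAC addrA.
  have := centered_min bB (om1 B bB df) muB l0 (esym muU).
  rewrite ls le_eqVlt => /predU1P[mun|mun]; last first.
    (* If [mu] is lower than [x], the multiple of [tau] that restores height [n] gives [x]
       all-positive coefficients. *)
    case: xo; split=> //; exists (mu + ((n%:R - \sum_i mu 0 i) / s) *: tau); split.
    - move=> i; rewrite mxE [X in _ + X]mxE ltr_wpDl// mulr_gt0// divr_gt0 ?subr_gt0//.
      exact: weight_gt0.
    - rewrite mulmxDl -scalemxAl -scalerA muV /c -addrA -scalerDl.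
      by rewrite -opprB addNr scale0r addr0.
    rewrite sum_rowD.
    by rewrite sum_rowZ divfK ?gt_eqF// ?weight_gt0// addrC subrK.
  have muVx : mu *m V = x by rewrite muV mun subrr scale0r addr0.
  exists B => //; exists mu => //; split=> //.
  + by move=> i iB; rewrite -lexE// yB.
  + by move=> i; rewrite inE.
  + by rewrite muVx.
move=> B B' x [bB df] [bB' df'] [l [lB l0 _ lV ls] lx] [l' [l'B l'0 _ l'V l's] l'x].
apply: (lexpos_basis_unique (y := x - n%:R *: c) genom genp) => // i iB.
  by rewrite -lx -ls -mul_centered supported_bcoordK// lexE// l0.
by rewrite -l'x -l's -mul_centered supported_bcoordK// lexE// l'0.
Qed.

End BoundaryDecomposition.

(** * Lattice polytopes *)

Lemma push_coefficients (R : realType) (m d k : nat) (V : 'M[R]_(m, d))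
    (B : {set 'I_m}) (f : 'I_k -> 'I_m) (c : 'I_k -> R) :
  (forall i, f i \in B) -> (forall i, 0 <= c i) ->
  exists l : 'rV[R]_m, [/\ supported B l, forall i, 0 <= l 0 i,
    \sum_i l 0 i = \sum_i c i & l *m V = \sum_i c i *: row (f i) V].
Proof.
move=> fB c0; exists (\sum_i c i *: delta_mx 0 (f i)); split.
- move=> j jB; rewrite summxE big1// => i _; rewrite !mxE/=.
  by case: eqP jB => [->|_ _]; rewrite ?fB// mulr0.
- by move=> j; rewrite summxE sumr_ge0// => i _; rewrite !mxE mulr_ge0.
- rewrite (eq_bigr (fun j => \sum_i c i * (delta_mx 0 (f i) : 'rV[R]_m) 0 j)).
    by rewrite exchange_big/=; apply: eq_bigr => i _; rewrite -mulr_sumr sum_delta mulr1.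
  by move=> j _; rewrite summxE; apply: eq_bigr => i _; rewrite mxE.
rewrite mulmx_suml; apply: eq_bigr => i _.
by rewrite -scalemxAl -rowE.
Qed.

Section Hull.
Variables (R : realType) (m d : nat) (V : 'M[R]_(m, d)).
Implicit Types (A B : {set 'I_m}) (l : 'rV[R]_m).

Definition row_hull B : set 'rV[R]_d :=
  [set x | exists l, [/\ supported B l, forall i, 0 <= l 0 i, \sum_i l 0 i = 1
    & x = l *m V]].

Lemma row_hull_row B i : i \in B -> row_hull B (row i V).
Proof.
move=> iB; exists (delta_mx 0 i); split=> //.
- exact: supported_delta.
- by move=> j; rewrite mxE ler0n.
- exact: sum_delta.
by rewrite rowE.
Qed.

Lemma row_hullS (A B : {set 'I_m}) : A \subset B -> row_hull A `<=` row_hull B.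
Proof.
move=> AB x [l [lA l0 ls xE]]; exists l; split=> // i iB; apply: lA.
by apply: contra iB; exact: (fintype.subsetP AB).
Qed.

(** As row [i] has weight less than 1 in [mu], it can be solved for: [nu], which is [mu] without
    entry [i] and renormalized, represents it by the other rows and replaces it in every
    combination. *)
Lemma row_hull_drop B i mu : supported B mu -> (forall j, 0 <= mu 0 j) ->
  \sum_j mu 0 j = 1 -> row i V = mu *m V -> mu 0 i < 1 ->
  row_hull (B :\ i) = row_hull B.
Proof.
move=> muB mu0 mus muV mui; apply/seteqP; split; first exact/row_hullS/subD1set.
move=> x [l [lB l0 ls ->]].
have i1 : 0 < 1 - mu 0 i by rewrite subr_gt0.
pose di : 'rV[R]_m := delta_mx 0 i.
pose nu := (1 - mu 0 i)^-1 *: (mu - mu 0 i *: di).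
have dE (k : 'rV[R]_m) : (k - k 0 i *: di) 0 i = 0.
  by rewrite !mxE !eqxx mulr1 subrr.
have dE' (k : 'rV[R]_m) j : j != i -> (k - k 0 i *: di) 0 j = k 0 j.
  by move=> ji; rewrite !mxE eqxx (negPf ji) mulr0 subr0.
have dS (k : 'rV[R]_m) : supported B k -> supported (B :\ i) (k - k 0 i *: di).
  move=> kB j; rewrite in_setD1 negb_and negbK => /predU1P[->|jB]; first exact: dE.
  have [->|ji] := eqVneq j i; first exact: dE.
  by rewrite dE'// kB.
have d0 (k : 'rV[R]_m) : (forall j, 0 <= k 0 j) -> forall j, 0 <= (k - k 0 i *: di) 0 j.
  move=> k0 j; have [->|ji] := eqVneq j i; first by rewrite dE.
  by rewrite dE'.
have ds (k : 'rV[R]_m) : \sum_j (k - k 0 i *: di) 0 j = \sum_j k 0 j - k 0 i.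
  by rewrite sum_rowB sum_rowZ sum_delta mulr1.
have dV (k : 'rV[R]_m) : (k - k 0 i *: di) *m V = k *m V - k 0 i *: row i V.
  by rewrite mulmxBl -scalemxAl -rowE.
exists ((l - l 0 i *: di) + l 0 i *: nu); split.
- apply: supportedD; first exact: dS.
  by move=> j jB; rewrite mxE [nu _ _]mxE dS// !mulr0.
- move=> j; rewrite mxE addr_ge0 ?d0// mxE mulr_ge0// mxE mulr_ge0 ?d0//.
  by rewrite invr_ge0 ltW.
- rewrite sum_rowD ds ls.
  by rewrite !sum_rowZ ds mus mulVf ?gt_eqF// mulr1 subrK.
rewrite mulmxDl dV -scalemxAl -scalemxAl dV -muV.
rewrite -{2}[row i V]scale1r -scalerBl [in X in _ + _ *: X]scalerA mulVf ?gt_eqF//.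
by rewrite scale1r subrK.
Qed.

(** If row [i] lies between [y] and [z], mixing their weights represents it. By irredundancy the
    mixture has weight 1 at [i], hence so do both ends, and both are row [i]. *)
Lemma row_hull_vertex B i : i \in B -> (row_hull (B :\ i) <> row_hull B) ->
  is_vertex (row_hull B) (row i V).
Proof.
move=> iB irr; split; first exact: row_hull_row.
move=> y z t [l [lB l0 ls yE]] [l' [l'B l'0 l's zE]] /andP[t0 t1] iE.
pose mu := t *: l + (1 - t) *: l'.
have le1 (k : 'rV[R]_m) j : (forall j, 0 <= k 0 j) -> \sum_j k 0 j = 1 -> k 0 j <= 1.
  by move=> k0 <-; rewrite (bigD1 j)//= lerDl sumr_ge0.
have t1' : 0 < 1 - t by rewrite subr_gt0.
have mus : \sum_j mu 0 j = 1.
  by rewrite sum_rowD !sum_rowZ ls l's; lra.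
have mu0 j : 0 <= mu 0 j.
  by rewrite !mxE addr_ge0// mulr_ge0// ltW.
have muB : supported B mu.
  by apply: supportedD => j jB; rewrite mxE ?lB ?l'B// mulr0.
have muV : row i V = mu *m V by rewrite mulmxDl -!scalemxAl -yE -zE.
have mui : mu 0 i = 1.
  apply/eqP; rewrite eq_le le1//= leNgt; apply/negP => mui.
  exact/irr/(row_hull_drop muB).
have /andP[/eqP li /eqP l'i] : (l 0 i == 1) && (l' 0 i == 1).
  move: mui (le1 l i l0 ls) (le1 l' i l'0 l's); rewrite !mxE => mui li l'i.
  have h1 : 0 <= t * (1 - l 0 i) by rewrite mulr_ge0 ?subr_ge0// ltW.
  have h2 : 0 <= (1 - t) * (1 - l' 0 i) by rewrite mulr_ge0 ?subr_ge0// ltW.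
  have e1 : t * (1 - l 0 i) = 0 by lra.
  have e2 : (1 - t) * (1 - l' 0 i) = 0 by lra.
  move: e1 e2 => /eqP + /eqP; rewrite !mulf_eq0 !subr_eq0 (gt_eqF t0) (gt_eqF t1) /=.
  by rewrite eq_sym => ->; rewrite eq_sym => ->.
have kE (k : 'rV[R]_m) : (forall j, 0 <= k 0 j) -> \sum_j k 0 j = 1 -> k 0 i = 1 ->
    k *m V = row i V.
  move=> k0 ks ki; rewrite rowE; congr (_ *m V); apply/rowP => j; rewrite mxE/=.
  have [->//|ji] := eqVneq j i.
  apply/eqP; rewrite eq_le k0 andbT.
  have : 0 <= \sum_(j' | (j' != i) && (j' != j)) k 0 j' by rewrite sumr_ge0.
  by move: ks; rewrite (bigD1 i)//= ki (bigD1 j)//=; lra.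
by rewrite yE zE !kE.
Qed.

End Hull.

Lemma conv_hull_row_hull (R : realType) (d : nat) (A : set 'rV[R]_d) : finite_set A ->
  exists (m : nat) (V : 'M[R]_(m, d)), conv_hull A = row_hull V [set: 'I_m].
Proof.
move=> /finite_seqP[s As]; exists (size s), (\matrix_(i < size s) nth 0 s i).
apply/seteqP; split=> [x [k [p [c [pA c0 c1 ->]]]]|x [l [_ l0 ls ->]]].
  have ps i : p i \in s by move: (pA i); rewrite As.
  have idx i : (index (p i) s < size s)%N by rewrite index_mem.
  have [l [lB l0 ls lE]] := push_coefficients (\matrix_(i < size s) nth 0 s i)
    (f := fun i => Ordinal (idx i)) (fun i => finset.in_setT _) c0.
  exists l; split=> //; first by rewrite ls.
  by rewrite lE; apply: eq_bigr => i _; rewrite rowK nth_index.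
exists (size s), (fun i => nth 0 s i), (l 0); split=> //.
  by move=> i; rewrite As /= mem_nth.
by rewrite mulmx_sum_row; apply: eq_bigr => i _; rewrite rowK.
Qed.

Lemma row_hull_irredundant (R : realType) (m d : nat) (V : 'M[R]_(m, d)) :
  exists B, row_hull V B = row_hull V [set: 'I_m] /\
    forall i, i \in B -> is_vertex (row_hull V B) (row i V).
Proof.
have full : `[<row_hull V [set: 'I_m] = row_hull V [set: 'I_m]>] by apply/asboolP.
have [B /minsetP[/asboolP BE Bmin] _] :=
  minset_exists (P := fun B => `[<row_hull V B = row_hull V [set: 'I_m]>]) full.
exists B; split=> // i iB; apply: row_hull_vertex => // E.
have /asboolP /Bmin : row_hull V (B :\ i) = row_hull V [set: 'I_m] by rewrite E.
by move=> /(_ (subD1set _ _)) E'; move: iB; rewrite -E' setD11.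
Qed.

(* Redundant generators are replaced by a copy of a vertex. *)
Lemma lattice_polytope_row_hull (R : realType) (d : nat) (P : set 'rV[R]_d) :
  lattice_polytope P -> exists (m : nat) (V : 'M[R]_(m, d)),
    [/\ forall i, integer_points (row i V), P = row_hull V [set: 'I_m]
      & row_full (row_mx V (const_mx 1 : 'cV_m))].
Proof.
move=> [[A /conv_hull_row_hull[m [V0 ->]] PA] [x0 [U [PU dU]]] Pint].
have [B [BE Bvert]] := row_hull_irredundant V0.
rewrite -BE in PA.
have PT (x : 'rV[R]_d) : aff_hull P x.
  rewrite PU; exists (x - x0); last by rewrite addrC subrK.
  suff -> : U = fullv by exact: memvf.
  by apply/eqP; rewrite eqEdim subvf dimvf dU dim_matrix; exact: (eq_leq (mul1n d)).
(* The affine hull contains 0, so [P] has a point, and its weights, of sum 1, cannot all vanish. *)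
have [i0 i0B] : exists i0, i0 \in B.
  have [k [p [c [pP c1 _]]]] := PT 0.
  case: k p c pP c1 => [|k] p c pP c1.
    by move/eqP: c1; rewrite big_ord0 eq_sym oner_eq0.
  have := pP ord0; rewrite PA => -[l [lB _ ls _]].
  apply/existsP; apply: contraT; rewrite negb_exists => /forallP nB.
  by have := oner_neq0 R; rewrite -ls big1 ?eqxx// => i _; rewrite lB.
pose r i := if i \in B then i else i0.
have rB i : r i \in B by rewrite /r; case: ifP.
pose V : 'M[R]_(m, d) := \matrix_i row (r i) V0.
have PV : P = row_hull V [set: 'I_m].
  rewrite PA; apply/seteqP; split=> x [l [lB l0 ls ->]].
    exists l; split=> //; first by move=> i; rewrite finset.in_setT.
    rewrite !mulmx_sum_row; apply: eq_bigr => i _; rewrite rowK /r.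
    by case: ifP => // iB; rewrite lB ?iB// !scale0r.
  have [l' [l'B l'0 l's l'E]] := push_coefficients V0 rB l0.
  exists l'; split=> //; first by rewrite l's.
  by rewrite l'E mulmx_sum_row; apply: eq_bigr => i _; rewrite rowK.
exists m, V; split=> //.
  by move=> i; rewrite rowK; apply: Pint; rewrite PA; exact: Bvert.
have aff (x : 'rV[R]_d) : exists l, x = l *m V /\ \sum_i l 0 i = 1.
  have [k [p [c [pP c1 ->]]]] := PT x.
  have /(_ _)/cid-/all_sig[q qE] i : exists l : 'rV[R]_m, p i = l *m V /\ \sum_i l 0 i = 1.
    by have := pP i; rewrite PV => -[l [_ _ ls ->]]; exists l.
  exists (\sum_i c i *: q i); split.
    by rewrite mulmx_suml; apply: eq_bigr => i _; rewrite -scalemxAl -(proj1 (qE i)).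
  rewrite -[RHS]c1 (eq_bigr (fun j => \sum_i c i * q i 0 j)); last first.
    by move=> j _; rewrite summxE; apply: eq_bigr => i _; rewrite mxE.
  rewrite exchange_big; apply: eq_bigr => i _.
  by rewrite -mulr_sumr (proj2 (qE i)) mulr1.
rewrite -sub1mx; apply/row_subP => j; set y := row j _.
have [l1 [xE l1s]] := aff (lsubmx y); have [l0 [zE l0s]] := aff 0.
have [e ye] : exists e, rsubmx y = e%:M by exists (rsubmx y 0 0); exact: mx11_scalar.
(* Here [l0] represents the origin with total weight 1, so its multiples adjust the last coordinate
   alone. *)
apply/submxP; exists (l1 + (e - 1) *: l0).
rewrite -[y]hsubmxK ye; apply/lift_mulP; split.
  by rewrite mulmxDl -scalemxAl -xE -zE scaler0 addr0.
by rewrite sum_rowD sum_rowZ l1s l0s mulr1 addrC subrK.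
Qed.

(** * Interior of a dilate and its lattice points *)

Section OpenCount.
Variables (R : realType) (m d : nat) (V : 'M[R]_(m, d)).
Hypothesis Wfull : row_full (row_mx V (const_mx 1 : 'cV[R]_m)).

Lemma dilate_row_hull n (x : 'rV[R]_d) : (0 < n)%N ->
  dilate n (row_hull V [set: 'I_m]) x <->
  exists l : 'rV[R]_m, [/\ forall i, 0 <= l 0 i, x = l *m V & \sum_i l 0 i = n%:R].
Proof.
move=> n0; have nR : n%:R != 0 :> R by rewrite pnatr_eq0 -lt0n.
split=> [[_ [l [_ l0 ls ->]] <-]|[l [l0 -> ls]]].
  exists (n%:R *: l); split; last by rewrite sum_rowZ ls mulr1.
    by move=> i; rewrite mxE mulr_ge0.
  by rewrite -scalemxAl.
exists (n%:R^-1 *: l *m V); last by rewrite -scalemxAl scalerA mulfV// scale1r.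
exists (n%:R^-1 *: l); split=> //.
- by move=> i; rewrite finset.in_setT.
- by move=> i; rewrite mxE mulr_ge0// invr_ge0.
by rewrite sum_rowZ ls mulVf.
Qed.

Lemma interior_dilate n (x : 'rV[R]_d) : (0 < n)%N ->
  (dilate n (row_hull V [set: 'I_m]))° x <->
  exists l : 'rV[R]_m, [/\ forall i, 0 < l 0 i, x = l *m V & \sum_i l 0 i = n%:R].
Proof.
move=> n0; set D := dilate _ _; have mR : 0 < m%:R :> R by rewrite ltr0n (row_count_gt0 Wfull).
split=> [xD|[l [l0 xl ls]]].
  pose tau : 'rV[R]_m := const_mx (n%:R / m%:R).
  have tau0 i : 0 < tau 0 i by rewrite mxE divr_gt0// ltr0n.
  have taus : \sum_i tau 0 i = n%:R.
    rewrite (eq_bigr (fun=> n%:R / m%:R)); last by move=> i _; rewrite mxE.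
    by rewrite sumr_const card_ord -[_ *+ m]mulr_natr divfK// gt_eqF.
  have : \forall t \near 0^'+, D (x + t *: (x - tau *m V)).
    have : x + t *: (x - tau *m V) @[t --> 0^'+] --> x + 0 *: (x - tau *m V).
      apply: cvg_at_right_filter; apply: cvgD; first exact: cvg_cst.
      by apply: cvgZr_tmp; exact: cvg_id.
    by rewrite scale0r addr0 => /(_ D xD).
  move=> /right_nearP[t t0 /(dilate_row_hull _ n0)[l [l0 lE ls]]].
  have t1 : 0 < 1 + t by rewrite ltr_pwDl// ltW.
  (* Moving [x] slightly away from the point [tau *m V] stays in the dilate; solving for [x] mixes
     in a positive share of every generator. *)
  exists ((1 + t)^-1 *: (l + t *: tau)); split.
  - move=> i; rewrite mxE mulr_gt0 ?invr_gt0//.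
    by rewrite mxE ltr_wpDl// mxE mulr_gt0.
  - rewrite -scalemxAl mulmxDl -lE -scalemxAl scalerBr addrA addrNK.
    by rewrite -{2}[x]scale1r -scalerDl scalerA mulVf ?scale1r// gt_eqF.
  by rewrite sum_rowZ sum_rowD sum_rowZ taus ls; field; rewrite gt_eqF.
(* Through [M], the displacement [y - x] gets coefficients of total weight 0 depending linearly on
   it; near [x] they are too small to spoil positivity. *)
pose M := usubmx (pinvmx (row_mx V (const_mx 1 : 'cV[R]_m))).
have MV : M *m row_mx V (const_mx 1 : 'cV[R]_m) = row_mx 1%:M 0.
  have /mulmxKpV := etrans (sub1mx _) Wfull; rewrite mul1mx => pW.
  rewrite mul_usub_mx pW.
  by rewrite (@scalar_mx_block _ d 1) /block_mx col_mxKu.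
have cvgx j : (y - x) 0 j @[y --> x] --> x 0 j - x 0 j.
  rewrite (_ : (fun y : 'rV[R]_d => (y - x) 0 j) = (fun y => y 0 j - x 0 j)); last first.
    by apply/funext => y; rewrite !mxE.
  have H := @coord_continuous R 1 d 0 j x.
  exact: (cvgB (FF := nbhs_filter x) H (@cvg_cst _ _ _ _ (nbhs_filter x))).
have cvgM i : ((y - x) *m M) 0 i @[y --> x] --> (0 : R).
  have -> : 0 = \sum_j (x 0 j - x 0 j) * M j i.
    by rewrite big1// => j _; rewrite subrr mul0r.
  rewrite (_ : (fun y => _) = (fun y => \sum_j (y - x) 0 j * M j i)); last first.
    by apply/funext => y; rewrite mxE.
  apply: cvg_big; [exact: add_continuous|exact: nbhs_filter|move=> j _].
  exact: (@cvgMr_tmp _ _ _ (nbhs_filter x) _ _ (M j i) (cvgx j)).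
have : \forall y \near x, forall i, 0 <= (l + (y - x) *m M) 0 i.
  apply: (@filter_forall _ _ _ _ (nbhs_filter x)) => i.
  have := @cvgr_gt _ _ _ (nbhs_filter x) _ _ (cvgM i) (- l 0 i).
  rewrite oppr_lt0 => /(_ (l0 i)); apply: filterS => y yl.
  by rewrite mxE; lra.
apply: filterS => y yl; apply/dilate_row_hull => //; exists (l + (y - x) *m M).
suff /lift_mulP[yE ys] : row_mx y n%:R%:M = (l + (y - x) *m M) *m row_mx V (const_mx 1 : 'cV[R]_m).
  by [].
rewrite mulmxDl -mulmxA MV mul_row1 mul_mx_row mulmx1 mulmx0 -xl ls add_row_mx.
by rewrite addrC subrK addr0.
Qed.

Lemma open_count_row_hull n : open_ehrhart_series (row_hull V [set: 'I_m]) n =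
  (ncard (open_points V n))%:R.
Proof.
rewrite /open_ehrhart_series; case: eqP => [->|/eqP n0].
  (* The series starts at 1; at 0 there are no open points, since positive coefficients cannot sum
     to 0. *)
  rewrite /ncard (_ : open_points V 0 = set0) ?fset_set0 ?cardfs0//.
  rewrite -subset0 => x [_ [l [l0 _ ls]]].
  have := l0 (Ordinal (row_count_gt0 Wfull)).
  have : 0 < \sum_i l 0 i.
    rewrite (bigD1 (Ordinal (row_count_gt0 Wfull)))//= ltr_pwDl// sumr_ge0// => i _.
    exact: ltW.
  by rewrite ls ltxx.
rewrite /open_count /ncard (_ : _ `&` _ = open_points V n)//; apply/seteqP; split=> x.
  by move=> [/interior_dilate xD xi]; split=> //; apply: xD; rewrite lt0n.
move=> [xi xl]; split=> //; apply/interior_dilate => //.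
by rewrite lt0n.
Qed.

End OpenCount.

(** * Numerators as counts in half-open parallelepipeds *)

Section BoxPolynomial.
Variables (R : realType) (m d k : nat) (V : 'M[R]_(m, d)) (X : 'M[R]_(m, k)).
Hypothesis Vint : forall i, integer_points (row i V).
Hypothesis indepX : forall B, indep X B -> indep (row_mx V (const_mx 1 : 'cV_m)) B.
Variables (om : 'cV[R]_m) (p : 'rV[R]_k).

(** Used with the lifted generators, where [k = d + 1], and with the projected ones, where [k = d].
    Bases have [k] elements, so no height above [k] occurs. *)
Definition box_poly : {poly R} :=
  \poly_(i < k.+1) (\sum_(B : {set 'I_m} | `[<optimal_basis X om B>])
    ncard (hbox V B (removed_facets X p B) B i))%:R.

Lemma coef_box_poly n : box_poly`_n =
  (\sum_(B : {set 'I_m} | `[<optimal_basis X om B>])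
    ncard (hbox V B (removed_facets X p B) B n))%:R.
Proof.
rewrite coef_poly; case: ltnP => // kn; rewrite big1// => B /asboolP[bB _].
by rewrite ncard_hbox_gt// (card_basis bB).
Qed.

Lemma iter_bdiff_half_open n :
  iter k (@bdiff _) (fun j => (\sum_(B : {set 'I_m} | `[<optimal_basis X om B>])
    ncard (hbox V B (removed_facets X p B) finset.set0 j))%:R : R) n = box_poly`_n.
Proof.
rewrite coef_box_poly natr_sum; under eq_iter_bdiff do rewrite natr_sum.
rewrite iter_bdiff_sum; apply: eq_bigr => B /asboolP[bB _].
by rewrite -iter_bdiff_hbox// ?(card_basis bB)//; exact/indepX/(proj1 bB).
Qed.

End BoxPolynomial.

Lemma eq_hbox (R : realType) (m d : nat) (V : 'M[R]_(m, d)) (B S S' : {set 'I_m}) n :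
  {in B, S =i S'} -> hbox V B S B n = hbox V B S' B n.
Proof.
move=> SS'; apply/seteqP; split=> l [lB l0 l1 lV ls]; split=> // i iB.
- by rewrite -SS'// l0.
- by rewrite -SS'// l1.
- by rewrite SS'// l0.
by rewrite SS'// l1.
Qed.

(** For generic [p], the directions [p] and [- p] remove complementary facets of every basis, so
    [hbox_reciprocity] applies termwise. *)
Lemma box_poly_reciprocity (R : realType) (m d k : nat) (V : 'M[R]_(m, d))
    (X : 'M[R]_(m, k)) (om : 'cV[R]_m) (p : 'rV[R]_k) i :
  (forall i, integer_points (row i V)) ->
  (forall B, indep X B -> indep (row_mx V (const_mx 1 : 'cV_m)) B) ->
  (forall B i, basis X B -> i \in B -> (p *m bcoord X B) 0 i != 0) -> (i <= k)%N ->
  (box_poly V X om (- p))`_(k - i) = (box_poly V X om p)`_i.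
Proof.
move=> Vint indepX genp ik; rewrite !coef_box_poly; congr (_%:R).
apply: eq_bigr => B /asboolP[bB _]; have kB := card_basis bB.
rewrite hbox_reciprocity ?kB ?leq_subr ?subKn//; last exact/indepX/(proj1 bB).
congr (ncard _); apply: eq_hbox => j jB.
rewrite finset.in_setC !inE mulNmx mxE oppr_lt0 -leNgt le_eqVlt.
by rewrite (negPf (genp _ _ bB jB)).
Qed.

Theorem theorem1p1 (R : realType) (d : nat) (P : set 'rV[R]_d) (h : {poly R})
    (hP : lattice_polytope P) (hh : open_ehrhart_numerator P h) :
  exists a b : {poly R},
    [/\ h = a - b,
        forall i : nat, 0 <= a`_i,
        forall i : nat, 0 <= b`_i,
        forall z : R, z != 0 -> a.[z] = z ^+ d.+1 * a.[z^-1]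
      & forall z : R, z != 0 -> b.[z] = z ^+ d * b.[z^-1] ].
Proof.
have [m [V [Vint PV Wfull]]] := lattice_polytope_row_hull hP.
pose W := row_mx V (const_mx 1 : 'cV[R]_m).
have [om [om0 omW _]] := generic_cost W.
have [tau tau0 tauW] := generic_direction W.
pose U := centered V tau.
have [om' [om'0 om'U om'1]] := generic_cost U.
have [tau' _ tau'U] := generic_direction U.
pose opn n : R := (ncard (open_points V n))%:R.
pose cls n : R := (ncard (closed_points V n))%:R.
pose hs := box_poly V W om (tau *m W).
pose b := box_poly V U om' (tau' *m U).
have indepU : forall B, indep U B -> indep W B by exact: indep_centered.
have hE : h = box_poly V W om (- (tau *m W)).
  apply/polyP => n; rewrite -hh fps_mul_sub1XX -[d.+1]addn1.
  rewrite -iter_bdiff_half_open//; apply: eq_iter_bdiff => j.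
  by rewrite PV open_count_row_hull// (open_points_decomposition Wfull j om0 omW tau0 tauW).
have clsE n : iter d.+1 (@bdiff _) cls n = hs`_n.
  rewrite -[d.+1]addn1 -iter_bdiff_half_open//; apply: eq_iter_bdiff => j.
  by rewrite /cls (closed_points_decomposition Wfull j om0 omW tau0 tauW).
have opnE n : iter d.+1 (@bdiff _) opn n = h`_n.
  rewrite hE -[d.+1]addn1 -iter_bdiff_half_open//; apply: eq_iter_bdiff => j.
  by rewrite /opn (open_points_decomposition Wfull j om0 omW tau0 tauW).
(* The boundary series needs only [d] differences, its simplicial cones having [d] generators; one
   more difference yields [hs - h]. *)
have bE n : iter d (@bdiff _) (fun j => cls j - opn j) n = b`_n.
  rewrite -iter_bdiff_half_open//; apply: eq_iter_bdiff => j.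
  rewrite -(boundary_decomposition Wfull tau0 j om'0 om'U om'1 tau'U).
  have sub := @open_points_sub _ _ _ V j.
  have fC := closed_points_finite V j.
  have := ncardU (finite_setD (open_points V j) fC) (sub_finite_set sub fC).
  by rewrite setUC setDUK// setDKI => /(_ erefl) cE; rewrite /cls /opn cE natrD addrK.
have bhs : (1 - 'X) * b = hs - h.
  apply/polyP => n; rewrite coefB -clsE -opnE -iter_bdiffB iterS (funext bE).
  by rewrite mulrBl mul1r coefB coefXM /bdiff; case: n.
have coef_ge0 (k : nat) (X : 'M[R]_(m, k)) (o : 'cV[R]_m) p i : 0 <= (box_poly V X o p)`_i.
  by rewrite coef_poly; case: ifP => // _; rewrite ler0n.
have deg0 (k : nat) (X : 'M[R]_(m, k)) (o : 'cV[R]_m) p i : (k < i)%N ->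
    (box_poly V X o p)`_i = 0.
  by move=> ki; rewrite coef_poly ltnS leqNgt ki.
have rev i : (i <= d.+1)%N -> h`_(d.+1 - i) = hs`_i.
  by rewrite hE -[d.+1]addn1 => id; exact: box_poly_reciprocity.
have h0 i : (d.+1 < i)%N -> h`_i = 0 by rewrite hE -[d.+1]addn1; exact: deg0.
have hs0 i : (d.+1 < i)%N -> hs`_i = 0 by rewrite -[d.+1]addn1; exact: deg0.
have recip := reciprocal_decomposition rev h0 hs0 bhs.
exists (h + b), b; split=> [|i|i|z z0|z z0].
- by rewrite addrK.
- by rewrite coefD hE addr_ge0// coef_ge0.
- exact: coef_ge0.
- exact: (proj1 (recip z z0)).
exact: (proj2 (recip z z0)).
Qed.
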